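(* Let $\theta>0$ and let $(U_i)_{i\ge1}$ be a random sequence in $[0,1]$ governed by the law $\mathbb{P}_\theta$. Let $(B_i)_{i\ge1}$ be the corresponding lower record indicators. For $n\ge 1$, let $\pi_n^U$ be the permutation of $\{U_1,\dots,U_n\}$ whose cycle structure is given by the inter-record stretches, and let $\pi_n$ be the corresponding permutation of $[n]=\{1,\dots,n\}$, with the same cycle structure. Then: 1. The $B_i$, $i\ge1$, are independent, $B_i$ being Bernoulli with parameter $\theta/(i-1+\theta)$. 2. For every $n\ge1$, conditionally on all the $B_i$ ($i\ge1$), the permutation $\pi_n$ is uniformly distributed among the permutations of $[n]$ whose cycle lengths, ordered by increasing lowest elements of the cycles, are given by the successive spacings between $1$'s in the sequence $(1,B_n,B_{n-1},\dots,B_1)$. 3. For every $n\ge1$, given $(B_i)_{1\le i\le n}$, the conditional distribution of $\pi_n$ is the same as that given by the Feller coupling procedure using $B_i(\theta)=B_i$ for all $1\le i\le n$. 4. For every $n\ge1$, the unconditional distribution of $\pi_n$ is the Ewens distribution with parameter $\theta$.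
   Context: The law $\mathbb{P}_\theta$: for $\theta>0$, $\mathbb{P}_\theta$ is the probability measure on infinite sequences $(U_i)_{i\ge1}$ in $[0,1]$ (with the Borel $\sigma$-algebra) such that $U_1$ has the Beta$(\theta,1)$ distribution (density $\theta u^{\theta-1}$ on $(0,1)$), and for every $n\ge1$, conditionally on $(U_1,\dots,U_n)$ with $\min(U_1,\dots,U_n)=r$, the variable $U_{n+1}$ has density $\theta(u/r)^{\theta-1}\mathbf{1}(u<r)+\mathbf{1}(u\ge r)$ on $0<u<1$. Under $\mathbb{P}_\theta$ the sequence almost surely has pairwise distinct terms and no smallest element, and the objects below are defined on this almost sure event. Lower records: for a sequence $(U_i)_{i\ge1}$ of pairwise distinct elements of $[0,1]$ with no smallest element, the lower record indices $1=I_1<I_2<\cdots$ are the indices $I$ such that $U_I<U_i$ for all $i<I$. The lower record indicators are $B_i=1$ if $i$ is a lower record index and $B_i=0$ otherwise. The inter-record stretches are $V_k=(U_{I_k},U_{I_k+1},\dots,U_{I_{k+1}-1})$, $k\ge1$. The permutations $\pi_n^U$ and $\pi_n$: $\pi_n^U$ is the permutation of $\{U_1,\dots,U_n\}$ defined by $\pi_n^U(U_{i-1})=U_i$ for all $i\in\{2,\dots,n\}$ that are not lower record indices, $\pi_n^U(U_{I_{k+1}-1})=U_{I_k}$ for every $k\ge1$ with $I_{k+1}-1\le n$, and $\pi_n^U(U_n)=U_{I_j}$ where $I_j$ is the last lower record index with $I_j\le n$. The permutation $\pi_n$ of $[n]$ is obtained from $\pi_n^U$ by renaming, for each $m\in[n]$,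 the $m$-th smallest element of $\{U_1,\dots,U_n\}$ as $m$. Spacings: the successive spacings between $1$'s in a finite $0$-$1$ sequence are the differences between the positions of consecutive $1$'s, listed from left to right. (Note that $B_1=1$ always.) Feller coupling procedure: given $\{0,1\}$-valued $(B_i(\theta))_{1\le i\le n}$ with $B_1(\theta)=1$, a random permutation $\sigma$ of $[n]$ is constructed as follows. Set $X_1:=1$, and recursively for $2\le i\le n$: if $B_{n+2-i}(\theta)=1$, $X_i$ is the smallest element of $[n]\setminus\{X_1,\dots,X_{i-1}\}$; if $B_{n+2-i}(\theta)=0$, then conditionally on $(B_j(\theta))_{1\le j\le n}$ and $X_1,\dots,X_{i-1}$, $X_i$ is uniformly distributed on $[n]\setminus\{X_1,\dots,X_{i-1}\}$. The sequence $(X_1,\dots,X_n)$ is cut into consecutive blocks, a new block starting at $X_i$ if and only if $i=1$ or $B_{n+2-i}(\theta)=1$; each block $(X_a,X_{a+1},\dots,X_b)$ is a cycle of $\sigma$, i.e. $\sigma(X_a)=X_{a+1},\dots,\sigma(X_{b-1})=X_b,\sigma(X_b)=X_a$. Ewens distribution with parameter $\theta$ on permutations of $[n]$: the probability of a permutation $\pi$ is $\theta^{K(\pi)}/(\theta)_n$, where $K(\pi)$ is the number of cycles of $\pi$ and $(\theta)_n=\theta(\theta+1)\cdots(\theta+n-1)$. *)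

(* Defs.v *)
From HB Require Import structures.
From mathcomp Require Import all_boot all_order all_algebra all_fingroup.
From mathcomp Require Import finmap.
From mathcomp Require Import all_classical all_reals all_analysis.
From mathcomp Require Import measurable_realfun.

Set Implicit Arguments.
Unset Strict Implicit.
Unset Printing Implicit Defensive.

Import Order.TTheory GRing.Theory Num.Theory.
Import numFieldNormedType.Exports.

Local Open Scope classical_set_scope.
Local Open Scope ring_scope.

(* Indices are 0-based: U 0, U 1, ... stand for U_1, U_2, ..., and likewise for
   the record indicators; 'I_n stands for [n], 0 being its least element. *)

HB.instance Definition _ (S : finType) := isPointed.Build (perm_type S) 1%g.
HB.instance Definition _ (S : finType) :=
  @isMeasurable.Build default_measure_display (perm_type S)
    discrete_measurable discrete_measurable0
    discrete_measurableC discrete_measurableU.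

Section conditioning.
Context d d' (T : measurableType d) (T' : measurableType d') (R : realType).

Definition mutually_independent (P : probability T R) (I : choiceType)
    (X : I -> {RV P >-> T'}) : Prop :=
  forall (J : {fset I}) (A : I -> set T'), (forall i, measurable (A i)) ->
    P (\bigcap_(i in [set` J]) (X i @^-1` A i)) =
    (\prod_(i <- J) P (X i @^-1` A i))%E.

Definition sigma_of (I : Type) (D : set I) (X : I -> T -> T') : set_system T :=
  <<s \bigcup_(i in D) preimage_set_system [set: T] (X i) measurable >>.

End conditioning.

(* kappa w is (a version of) the conditional distribution of Y given the
   sub-sigma-algebra G, evaluated at the sample point w. *)
Definition is_cond_distribution d d' (T : measurableType d)
    (T' : measurableType d') (R : realType) (P : probability T R)
    (G : set_system T) (Y : {RV P >-> T'}) (kappa : T -> set T' -> \bar R) :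
    Prop :=
  forall A : set T', measurable A ->
    measurable_fun [set: g_sigma_algebraType G]
      (fun w : g_sigma_algebraType G => kappa w A) /\
    forall E : set T, <<s G >> E ->
      P (E `&` Y @^-1` A) = (\int[P]_(w in E) kappa w A)%E.

Definition finite_law (R : realType) (S : finType) (p : S -> R) (A : set S) :
    \bar R :=
  (\sum_(s | s \in A) p s)%:E.

Definition uniform_pmf (R : realType) (S : finType) (C : {set S}) (s : S) : R :=
  (s \in C)%:R / #|C|%:R.

Section law_Ptheta.
Context (R : realType).

(* The library's beta_pdf only takes parameters in nat. *)
Definition beta_theta_1_density (theta u : R) : R :=
  theta * u `^ (theta - 1).

Definition Ptheta_density (theta r u : R) : R :=
  theta * (u / r) `^ (theta - 1) * (u < r)%R%:R + (r <= u)%R%:R.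

Definition density_law (f : R -> R) (A : set R) : \bar R :=
  (\int[lebesgue_measure]_(u in A `&` `]0%R, 1%R[) (f u)%:E)%E.

Definition has_law_Ptheta d (T : measurableType d) (P : probability T R)
    (theta : R) (U : nat -> {RV P >-> R}) : Prop :=
  [/\ forall i w, 0 <= U i w <= 1,
      forall A : set R, measurable A ->
        distribution P (U 0%N) A = density_law (beta_theta_1_density theta) A
    & forall n : nat,
        is_cond_distribution (sigma_of `I_n.+1 (fun i => U i : T -> R)) (U n.+1)
          (fun w => density_law (Ptheta_density theta
                      (\big[Num.min/U 0%N w]_(i < n.+1) U i w)))].

End law_Ptheta.

Section records.
Context (R : realType).
Implicit Types (u : nat -> R) (n : nat).

Definition is_lower_record u (i : nat) : bool := [forall j : 'I_i, u i < u j].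

Definition last_record u (i : nat) : nat :=
  (\max_(j < i.+1 | is_lower_record u j) j)%N.

(* pi_n^U, as a function on the values u_0, ..., u_(n-1). The three clauses of
   its definition collapse to two: an index i.+1 < n which is not a record is
   the successor of i in its stretch; otherwise i ends its stretch (or is the
   last index), and is sent to the record that started it. Meaningful when u_0, ..., u_(n-1) are pairwise distinct and x is one of
   them. *)
Definition perm_piU u n (x : R) : R :=
  let i := index x (mkseq u n) in
  if (i.+1 < n)%N && ~~ is_lower_record u i.+1 then u i.+1
  else u (last_record u i).

Definition nth_smallest u n (m : nat) : R := nth 0 (sort <=%R (mkseq u n)) m.

(* The default value 1%g is only taken when u_0, ..., u_(n-1) are not pairwise
   distinct: see perm_piP and perm_pi_unique. *)
Definition perm_pi u n : {perm 'I_n} :=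
  odflt 1%g [pick s : {perm 'I_n} | [forall m : 'I_n,
    nth_smallest u n (s m) == perm_piU u n (nth_smallest u n m)]].

Lemma last_recordP u i : is_lower_record u (last_record u i) /\
  (last_record u i <= i)%N.
Proof.
have r0 : is_lower_record u (@ord0 i) by apply/forallP => -[].
rewrite /last_record (bigop.bigmax_eq_arg ord0)//.
by case: arg_maxnP => //= j rj _; split => //; rewrite -ltnS ltn_ord.
Qed.

Lemma last_record_max u i j : is_lower_record u j -> (j <= i)%N ->
  (j <= last_record u i)%N.
Proof.
move=> rj ji; have ji' : (j < i.+1)%N by [].
by apply: (@leq_bigmax_cond _ (fun k : 'I_i.+1 => is_lower_record u k)
  (fun k : 'I_i.+1 => k : nat) (Ordinal ji')).
Qed.

Let next u n i := if (i.+1 < n)%N && ~~ is_lower_record u i.+1 then i.+1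
  else last_record u i.

Let next_lt u n i : (i < n)%N -> (next u n i < n)%N.
Proof.
move=> iltn; rewrite /next; case: ifPn => [/andP[]//|_].
exact: leq_ltn_trans (last_recordP u i).2 iltn.
Qed.

Let next_inj u n i j : (i < n)%N -> (j < n)%N -> next u n i = next u n j ->
  i = j.
Proof.
wlog ij : i j / (i <= j)%N.
  move=> h iltn jltn e; case: (leqP i j) => [|/ltnW] ij; first exact: h.
  by apply/esym/h.
move=> iltn jltn; rewrite /next.
case: ifPn => [/andP[_ ri]|Ri]; case: ifPn => [/andP[_ rj]|Rj].
- by case.
- by move=> e; move: (last_recordP u j).1; rewrite -e (negbTE ri).
- by move=> e; move: (last_recordP u i).1; rewrite e (negbTE rj).
- move=> e; apply/eqP; rewrite eqn_leq ij /= leqNgt; apply/negP => ij'.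
  move: Ri; rewrite (leq_ltn_trans ij' jltn) /= negbK => /last_record_max.
  by move=> /(_ _ ij'); rewrite -e ltnNge (last_recordP u i).2.
Qed.

Lemma perm_piP u n : uniq (mkseq u n) -> forall m : 'I_n,
  nth_smallest u n (perm_pi u n m) = perm_piU u n (nth_smallest u n m).
Proof.
move=> uu; pose t := sort <=%R (mkseq u n).
have st : size t = n by rewrite size_sort size_mkseq.
have ut : uniq t by rewrite sort_uniq.
have piUE x : x \in mkseq u n ->
    perm_piU u n x = u (next u n (index x (mkseq u n))).
  by rewrite /perm_piU /next; case: ifP.
have idx x : x \in mkseq u n -> (index x (mkseq u n) < n)%N.
  by rewrite -index_mem size_mkseq.
have mt (m : 'I_n) : nth_smallest u n m \in mkseq u n.
  by rewrite -(mem_sort <=%R) mem_nth // st.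
have lt (m : 'I_n) : (index (perm_piU u n (nth_smallest u n m)) t < n)%N.
  rewrite -[X in (_ < X)%N]st index_mem mem_sort piUE //.
  by apply/mapP; exists (next u n (index (nth_smallest u n m) (mkseq u n)));
    rewrite // mem_iota /= next_lt ?idx.
pose f (m : 'I_n) := Ordinal (lt m).
have fE m : nth_smallest u n (f m) = perm_piU u n (nth_smallest u n m).
  by rewrite /nth_smallest nth_index // -index_mem -/t st; apply: lt.
have uinj i j : (i < n)%N -> (j < n)%N -> u i = u j -> i = j.
  by move=> iltn jltn; move/mkseq_uniqP: uu => h e; apply: h.
have fi : injective f.
  move=> m m' e; have := congr1 (fun k : 'I_n => nth_smallest u n k) e.
  rewrite !fE !piUE // => /uinj => /(_ (next_lt u (idx _ (mt m))) (next_lt u (idx _ (mt m')))).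
  move=> /(next_inj (idx _ (mt m)) (idx _ (mt m'))) e1.
  have {}e1 : nth_smallest u n m = nth_smallest u n m'.
    by rewrite -(nth_index 0 (mt m)) e1 nth_index.
  by apply/val_inj/eqP; rewrite -(nth_uniq 0 _ _ ut) ?st ?ltn_ord //; apply/eqP.
move=> m0; rewrite /perm_pi; case: pickP => [s /forallP h|noperm].
  exact/eqP/h.
suff : false by [].
by rewrite -(noperm (perm fi)); apply/forallP => m; rewrite permE fE.
Qed.

Lemma perm_pi_unique u n (s : {perm 'I_n}) : uniq (mkseq u n) ->
  (forall m : 'I_n, nth_smallest u n (s m) = perm_piU u n (nth_smallest u n m)) ->
  s = perm_pi u n.
Proof.
move=> uu h; apply/permP => m; apply/val_inj/eqP.
rewrite -(@nth_uniq _ 0 (sort <=%R (mkseq u n))) ?sort_uniq ?size_sort ?size_mkseq ?ltn_ord //.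
by apply/eqP; rewrite [LHS]h -perm_piP.
Qed.

(* perm_pi only depends on the relative order of u_0, ..., u_(n-1). *)
Lemma eq_perm_pi u v n :
  (forall i j, (i < n)%N -> (j < n)%N -> (u i <= u j) = (v i <= v j)) ->
  perm_pi u n = perm_pi v n.
Proof.
move=> uv.
have uvlt i j : (i < n)%N -> (j < n)%N -> (u i < u j) = (v i < v j).
  by move=> ? ?; rewrite !ltNge uv.
have uveq i j : (i < n)%N -> (j < n)%N -> (u i == u j) = (v i == v j).
  by move=> ? ?; rewrite !eq_le !uv.
have rec i : (i < n)%N -> is_lower_record u i = is_lower_record v i.
  move=> iltn; apply: eq_forallb => j; apply: uvlt => //.
  exact: ltn_trans iltn.
have lst i : (i < n)%N -> last_record u i = last_record v i.
  move=> iltn; apply: eq_bigl => j; apply: rec.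
  by apply: leq_trans iltn.
pose su := sort (relpre u <=%R) (iota 0 n).
have suv : sort (relpre v <=%R) (iota 0 n) = su.
  rewrite /su -val_enum_ord !sort_map; do 2 congr map.
  apply: (congr1 (fun e => path.sort e _)).
  by apply/funext => i; apply/funext => j /=; rewrite uv.
have osu (m : 'I_n) : nth_smallest u n m = u (nth 0%N su m).
  by rewrite /nth_smallest /mkseq sort_map (nth_map 0%N) // size_sort size_iota.
have osv (m : 'I_n) : nth_smallest v n m = v (nth 0%N su m).
  by rewrite /nth_smallest /mkseq sort_map suv (nth_map 0%N) // size_sort size_iota.
have sul (m : 'I_n) : (nth 0%N su m < n)%N.
  have : nth 0%N su m \in su by rewrite mem_nth // size_sort size_iota.
  by rewrite mem_sort mem_iota.
have idx k : (k < n)%N -> index (u k) (mkseq u n) = index (v k) (mkseq v n).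
  move=> kltn; rewrite /index /mkseq !find_map; apply: eq_in_find => i.
  by rewrite mem_iota /= => iltn; apply: uveq.
have idn k : (k < n)%N -> (index (u k) (mkseq u n) < n)%N.
  move=> kltn; rewrite -[X in (_ < X)%N](size_mkseq u n) index_mem.
  by apply/mapP; exists k; rewrite ?mem_iota.
rewrite /perm_pi; congr odflt; apply: eq_pick => s; apply: eq_forallb => m.
rewrite !osu !osv /perm_piU -idx //.
have := idn _ (sul m); set i := index _ _ => iltn.
case: (ltnP i.+1 n) => /= [i1n|_]; last first.
  rewrite lst // uveq //; apply: leq_ltn_trans iltn.
  exact: (last_recordP v i).2.
rewrite rec //; case: ifP => _; rewrite ?lst // uveq //.
by apply: leq_ltn_trans iltn; exact: (last_recordP v i).2.
Qed.

End records.

Section record_variables.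
Context d (T : measurableType d) (R : realType) (P : probability T R).
Variable U : nat -> {RV P >-> R}.

Definition record_indicator (i : nat) (w : T) : bool :=
  is_lower_record (fun j => U j w) i.

Definition perm_pi_rv (n : nat) (w : T) : {perm 'I_n} := perm_pi (fun j => U j w) n.

Let measurable_record_indicator i :
  measurable_fun [set: T] (record_indicator i).
Proof.
apply: (@measurable_fun_bool _ _ _ _ true); rewrite setTI.
rewrite (_ : _ @^-1` _ =
    \bigcap_(j in [set: 'I_i]) [set w | U i w < U j w]); last first.
  apply/seteqP; split => w /=.
    by move=> /forallP h j _ /=.
  by move=> h; apply/forallP => j; apply: h.
apply: fin_bigcap_measurable => // j _.
have := @measurable_fun_ltr _ T R setT (U i) (U j) (measurable_funPT _) (measurable_funPT _).
by move=> /(_ measurableT [set true] I); rewrite setTI.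
Qed.

HB.instance Definition _ (i : nat) :=
  isMeasurableFun.Build _ _ _ _ (record_indicator i)
    (measurable_record_indicator i).

Let measurable_perm_pi_rv n : measurable_fun [set: T] (perm_pi_rv n).
Proof.
pose c w := [ffun ij : 'I_n * 'I_n => U ij.1 w <= U ij.2 w].
move=> _ A _; rewrite setTI.
rewrite (_ : _ @^-1` A = \bigcup_(g in [set g | exists2 w, c w = g & A (perm_pi_rv n w)])
   [set w | c w = g]); last first.
  apply/seteqP; split => [w Aw|w [g [w' e Aw'] /= e']].
    by exists (c w) => //; exists w.
  rewrite /= (_ : perm_pi_rv n w = perm_pi_rv n w') //.
  apply: eq_perm_pi => i j iltn jltn.
  move: e; rewrite -e' => /ffunP/(_ (Ordinal iltn, Ordinal jltn)).
  by rewrite !ffunE.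
apply: fin_bigcup_measurable => [|g _]; first exact: finite_finset.
rewrite (_ : [set w | c w = g] =
  \bigcap_(ij in [set: 'I_n * 'I_n]) [set w | (U ij.1 w <= U ij.2 w) = g ij]);
  last first.
  apply/seteqP; split => w /=.
    by move=> <- ij _ /=; rewrite ffunE.
  by move=> h; apply/ffunP => ij; rewrite ffunE; apply: h.
apply: fin_bigcap_measurable => // ij _.
have := @measurable_fun_ler _ T R setT (U ij.1) (U ij.2) (measurable_funPT _) (measurable_funPT _).
by move=> /(_ measurableT [set g ij] I); rewrite setTI.
Qed.

HB.instance Definition _ (n : nat) :=
  isMeasurableFun.Build _ _ _ _ (perm_pi_rv n) (measurable_perm_pi_rv (n := n)).

End record_variables.

Section cycle_lengths.

Definition spacings (s : seq bool) : seq nat :=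
  behead (pairmap (fun x y => y - x)%N 0%N
    [seq i <- iota 0 (size s) | nth false s i]).

Definition cycle_lengths n (s : {perm 'I_n}) : seq nat :=
  [seq #|porbit s m| | m <- enum 'I_n & [forall j in porbit s m, (m <= j)%N]].

Definition perms_with_spacings n (b : nat -> bool) : {set {perm 'I_n}} :=
  [set s : {perm 'I_n} |
    cycle_lengths s == spacings (true :: rev (mkseq b n))].

End cycle_lengths.

Section feller.
Context (R : realType) (n : nat) (b : nat -> bool).

(* In 1-based notation: X_(i+1) starts a block iff i = 0 or
   B_(n+2-(i+1)) = 1, and B_(n+1-i) is b (n - i). *)
Definition feller_block_start (i : nat) : bool := (i == 0)%N || b (n - i).

(* Conditional probability that the next term is x, given b and the previous
   terms xs. *)
Definition feller_step (xs : seq 'I_n) (x : 'I_n) : R :=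
  let i := size xs in
  if i == 0%N then ((x : nat) == 0%N)%:R
  else if b (n - i) then
    ((x \notin xs) && [forall y : 'I_n, (y \notin xs) ==> (x <= y)%N])%:R
  else uniform_pmf R [set y : 'I_n | y \notin xs] x.

Definition feller_seq_pmf (x : n.-tuple 'I_n) : R :=
  \prod_(i < n) feller_step (take i x) (tnth x i).

Definition feller_next (i : nat) : nat :=
  if (i.+1 < n)%N && ~~ feller_block_start i.+1 then i.+1
  else (\max_(j < i.+1 | feller_block_start j) j)%N.

Definition is_feller_perm (x : n.-tuple 'I_n) (s : {perm 'I_n}) : bool :=
  [forall i : 'I_n, s (tnth x i) == nth (tnth x i) x (feller_next i)].

(* Sequences x with repetitions have probability 0, and the other ones
   determine the permutation. *)
Definition feller_pmf (s : {perm 'I_n}) : R :=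
  \sum_(x : n.-tuple 'I_n | is_feller_perm x s) feller_seq_pmf x.

End feller.

Definition ewens_pmf (R : realType) (theta : R) n (s : {perm 'I_n}) : R :=
  theta ^+ #|porbits s| / \prod_(i < n) (theta + i%:R).

(* Main.v *)
Require Import Defs.
From HB Require Import structures.
From mathcomp Require Import all_boot all_order all_algebra all_fingroup.
From mathcomp Require Import finmap.
From mathcomp Require Import all_classical all_reals all_analysis.
From mathcomp Require Import measurable_realfun.
From mathcomp Require Import ring lra zify.

(** Write [K] for the number of lower records among the first [n] terms and
    [m] for their minimum.  Each conditional density contributes [1] at a
    non-record and [theta * u `^ (theta - 1) * r `^ (1 - theta)] at a record [u]
    below the former minimum [r], so the product telescopes: the joint density
    is [theta ^+ K * m `^ (theta - 1)].  Among the vectors with a prescribed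
    set of values the order of appearance is felt only through [K].  Hence an
    order pattern [q] has probability proportional to [theta ^+ K(q)]
    ([pattern_law]).

    The telescoping is carried out on events instead of densities, which avoids
    iterated integrals.  Cut the unit interval into [N] equal cells.  The
    probability that the first terms lie in prescribed distinct cells is
    [theta ^+ K], times a power of [1 / N], times the integral of
    [u `^ (theta - 1)] over the lowest of these cells ([grid_law]).  On a fine
    grid two terms fall into one cell with small probability ([distinct_cells]),
    because the conditional densities have a common integrable bound.  This
    gives lower bounds on the probabilities of the patterns which sum to almost
    [1], so they are attained in the limit; the total mass [1] supplies the
    normalising constant and no Beta integral is computed.

    The rest is combinatorics of patterns.  A pattern is the same thing as the
    sequence of its relative ranks, where the [i]-th one takes arbitrary values
    from [0] to [i] ([sum_relrank]), and [i] is a lower record exactly when its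
    relative rank is [0].  So [theta ^+ K] is a product of one weight per
    relative rank: the relative ranks are independent, the normalising constant
    is the product of the [theta + i] ([relrank_law]), and the law of the record
    indicators follows ([records_joint_law]).

    List the record stretches from the last one to the first one and replace
    values by ranks.  Each stretch starts with its least element and the
    starting values increase along this list, so the result is the canonical
    cycle notation of [pi_n]: every cycle is opened by its least element, and
    the cycles are in increasing order of these ([feller_seq]).  The spacings of
    the records are thus the cycle lengths ([cycle_lengths_perm_pi]), and as the
    notation can be read back from the permutation, the map from patterns to
    [pi_n] is injective ([perm_pi_inj]), hence a bijection of the symmetric
    group, under which records become cycles.  This is the Ewens law
    ([ewens_law]).  Given the first [n] indicators the pattern is uniform among
    those with these records, and the later indicators depend on the later
    relative ranks only.  This is the conditional law on cylinders
    ([cylinder_conditional_law]), and uniqueness of measures extends it to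
    the sigma-algebra of all the indicators ([records_conditional_law]).

    Finally, all the sequences which the Feller coupling can produce have the
    same probability, and they are the canonical cycle notations of the
    permutations with the prescribed spacings.  Hence the coupling has the same
    uniform law ([feller_pmf_uniform]). *)

Import Order.TTheory GRing.Theory Num.Theory.

Local Open Scope classical_set_scope.
Local Open Scope ring_scope.

Set Implicit Arguments.
Unset Strict Implicit.
Unset Printing Implicit Defensive.

(** * Measures given by densities, and finite unions *)
Section density.
Context d d' (T : measurableType d) (Y : measurableType d') (R : realType).
Variables (mu : {measure set T -> \bar R}) (nu : {measure set Y -> \bar R}).
Variables (phi : T -> Y) (g : T -> R) (f : Y -> \bar R).

Local Open Scope ereal_scope.
Import HBNNSimple.

(** Change of variables and of density in one step: [nu] is the image under
    [phi] of the measure with density [g].  The hypothesis is the case of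
    indicators, and simple functions increasing to [f] give the rest. *)
Lemma integral_density :
  measurable_fun [set: T] phi -> measurable_fun [set: T] g ->
  (forall x, 0 <= g x)%R ->
  (forall A, measurable A -> nu A = \int[mu]_(x in phi @^-1` A) (g x)%:E) ->
  measurable_fun [set: Y] f -> (forall y, 0 <= f y) ->
  \int[nu]_y f y = \int[mu]_x (f (phi x) * (g x)%:E).
Proof.
move=> mphi mg g0 nuE mf f0.
pose f_ := nnsfun_approx measurableT mf.
have f_cvg y : (f_ n y)%:E @[n --> \oo] --> f y.
  by apply: (cvg_nnsfun_approx measurableT mf).
have f_nd y : {homo (fun n => (f_ n y)%:E) : m n / (m <= n)%N >-> m <= n}.
  by move=> m n mn; rewrite lee_fin; exact/lefP/nd_nnsfun_approx.
have mf_phi n : measurable_fun [set: T] (fun x => (f_ n (phi x))%:E).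
  by apply/measurable_EFinP; apply: measurableT_comp.
have mgE : measurable_fun [set: T] (EFin \o g) by exact/measurable_EFinP.
have -> : \int[nu]_y f y = limn (fun n => \int[nu]_y (f_ n y)%:E).
  rewrite -monotone_convergence//.
  - by apply: eq_integral => y _; apply/esym/cvg_lim => //; exact: f_cvg.
  - by move=> n; exact/measurable_EFinP/measurable_funP.
  - by move=> n y _; rewrite lee_fin.
have -> : \int[mu]_x (f (phi x) * (g x)%:E) =
    limn (fun n => \int[mu]_x ((f_ n (phi x))%:E * (g x)%:E)).
  rewrite -monotone_convergence//.
  - apply: eq_integral => x _; apply/esym/cvg_lim => //.
    by apply: cvgeZr => //; exact: f_cvg.
  - by move=> n; apply: emeasurable_funM.
  - by move=> n x _; rewrite mule_ge0// lee_fin.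
  - by move=> x _ m n mn; rewrite lee_wpmul2r ?lee_fin// -lee_fin f_nd.
congr (limn _); apply/funext => n.
have mpre r : measurable (phi @^-1` (f_ n @^-1` [set r])).
  by rewrite -(setTI (phi @^-1` _)); exact: mphi.
under eq_integral do rewrite fimfunE -fsumEFin//.
under [RHS]eq_integral.
  move=> x _; rewrite fimfunE -fsumEFin// ge0_mule_fsuml; last first.
    by move=> k; rewrite EFinM nnfun_muleindic_ge0.
  over.
rewrite ge0_integral_fsum//; last 2 first.
- by move=> r; exact/measurable_EFinP/measurable_funM.
- by move=> r y _; rewrite EFinM nnfun_muleindic_ge0.
rewrite ge0_integral_fsum//; last 2 first.
- move=> r; apply: emeasurable_funM => //; apply/measurable_EFinP.
  apply: measurable_funM => //.
  by apply: (measurableT_comp _ mphi); exact: measurable_indic.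
- move=> r x _; rewrite mule_ge0 ?lee_fin//.
  by rewrite -lee_fin EFinM nnfun_muleindic_ge0.
apply: eq_fsbigr => r /[!inE] -[y _ <-{r}].
rewrite integralZl_indic_nnsfun// integral_indic// setIT nuE//.
rewrite [in LHS]integral_mkcond -ge0_integralZl//; last 3 first.
- by apply/(measurable_restrictT _ (mpre _)); exact: measurable_funTS.
- by move=> x _; rewrite erestrict_ge0// => z _; rewrite lee_fin.
- by rewrite lee_fin.
apply: eq_integral => x _.
rewrite EFinM -muleA; congr (_ * _).
rewrite /patch indicE (_ : (x \in _) = (phi x \in f_ n @^-1` [set f_ n y])).
  by case: ifP; rewrite ?mul1e ?mul0e.
by apply/idP/idP; rewrite !inE.
Qed.
End density.

Section density_measure.
Context d (T : measurableType d) (R : realType) (mu : {measure set T -> \bar R}).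
Variable f : T -> \bar R.

(** The measure with density [f] is given a measure structure so that the theorem
    on uniqueness of measures applies to it. *)
Definition density_measure (mf : measurable_fun [set: T] f)
    (f0 : forall x, (0 <= f x)%E) (A : set T) : \bar R := (\int[mu]_(x in A) f x)%E.

Variables (mf : measurable_fun [set: T] f) (f0 : forall x, (0 <= f x)%E).

Let density0 : density_measure mf f0 set0 = 0%E.
Proof. exact: integral_set0. Qed.

Let density_ge0 A : (0 <= density_measure mf f0 A)%E.
Proof. exact: integral_ge0. Qed.

Let density_sigma_additive : semi_sigma_additive (density_measure mf f0).
Proof.
move=> /= F mF tF mUF; apply: cvg_toP.
  apply: ereal_nondecreasing_is_cvgn => m n mn.
  by apply: lee_sum_nneg_natr => // k _ _; exact: density_ge0.
by rewrite /density_measure ge0_integral_bigcup//; exact: measurable_funTS.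
Qed.

HB.instance Definition _ := isMeasure.Build _ _ _ (density_measure mf f0)
  density0 density_ge0 density_sigma_additive.
End density_measure.

Section finite_unions.
Context d (T : measurableType d) (R : realType).
Variables (mu : {measure set T -> \bar R}) (I : finType) (F : I -> set T).
Hypothesis mF : forall i, measurable (F i).

Lemma bigcup_finType : \bigcup_i F i = \big[setU/set0]_i F i.
Proof.
rewrite -bigcup_seq; apply: eq_bigcupl; split => // i _ /=.
exact: mem_index_enum.
Qed.

Lemma measure_bigcup_finType : trivIset [set: I] F ->
  mu (\bigcup_i F i) = (\sum_i mu (F i))%E.
Proof.
move=> tF; rewrite measure_fin_bigcup//; last exact: finite_finset.
rewrite [RHS]fsbig_seq ?index_enum_uniq// [in RHS](_ : [set` _] = [set: I])//.
by apply/seteqP; split => // i _ /=; exact: mem_index_enum.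
Qed.

Lemma measure_bigcup_finType_le : (mu (\bigcup_i F i) <= \sum_i mu (F i))%E.
Proof.
rewrite bigcup_finType; elim: (index_enum I) => [|i r IH].
  by rewrite !big_nil measure0.
rewrite !big_cons (le_trans (measureU2 _ _ _))//; first exact: bigsetU_measurable.
by rewrite leeD2l.
Qed.
End finite_unions.

(** * Running minima and lower records *)
Definition running_min (R : realType) (u : nat -> R) (n : nat) : R :=
  \big[Num.min/u 0%N]_(i < n.+1) u i.

Definition num_records (R : realType) (u : nat -> R) (n : nat) : nat :=
  \sum_(i < n) is_lower_record u i.

Section running_min.
Context (R : realType).
Implicit Types u : nat -> R.

Lemma running_min_le u n i : (i <= n)%N -> running_min u n <= u i.
Proof. by move=> ilen; apply: (bigmin_le (u 0%N) (Ordinal (ilen : (i < n.+1)%N))). Qed.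

Lemma le_running_min u n x :
  (forall i, (i <= n)%N -> x <= u i) -> x <= running_min u n.
Proof. by move=> h; apply: le_bigmin => [|i _]; apply: h; rewrite // -ltnS. Qed.

Lemma running_min0 u : running_min u 0%N = u 0%N.
Proof.
apply/eqP; rewrite eq_le running_min_le//= le_running_min// => i.
by rewrite leqn0 => /eqP ->.
Qed.

Lemma running_minS u n :
  running_min u n.+1 = Num.min (running_min u n) (u n.+1).
Proof.
apply/eqP; rewrite eq_le; apply/andP; split.
  rewrite le_min running_min_le// andbT; apply: le_running_min => i ilen.
  by rewrite running_min_le// leqW.
apply: le_running_min => i; rewrite leq_eqVlt => /predU1P[->|].
  by rewrite ge_min lexx orbT.
by rewrite ltnS ge_min => ilen; rewrite running_min_le.
Qed.

Lemma running_min_mem u n : exists2 i, (i <= n)%N & running_min u n = u i.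
Proof.
elim: n => [|n [i ilen IH]]; first by exists 0%N; rewrite ?running_min0.
rewrite running_minS IH; case: (leP (u i) (u n.+1)) => _; last by exists n.+1.
by exists i; rewrite // leqW.
Qed.

Lemma is_lower_recordS u n : is_lower_record u n.+1 = (u n.+1 < running_min u n).
Proof.
apply/forallP/idP => [h|h j].
  by have [i ilen ->] := running_min_mem u n; exact: (h (Ordinal (ilen : (i < n.+1)%N))).
by apply: (lt_le_trans h); apply: running_min_le; rewrite -ltnS.
Qed.

Lemma num_recordsS u n :
  num_records u n.+1 = (num_records u n + is_lower_record u n)%N.
Proof. by rewrite /num_records big_ord_recr. Qed.

Lemma is_lower_record0 u : is_lower_record u 0%N.
Proof. by apply/forallP => -[]. Qed.
End running_min.

(** * Cells of a regular grid *)
Section grid.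
Context (R : realType) (N : nat).
Hypothesis N_gt0 : (0 < N)%N.

Definition cell (k : nat) : set R := `[k%:R / N%:R, k.+1%:R / N%:R[.

Lemma measurable_cell k : measurable (cell k).
Proof. exact: measurable_itv. Qed.

Lemma cell_lt k l x y : (k < l)%N -> cell k x -> cell l y -> x < y.
Proof.
rewrite /cell /= !in_itv /= => kl /andP[_ xk] /andP[ly _].
apply: (lt_le_trans xk); apply: le_trans ly.
by rewrite ler_pM2r ?invr_gt0 ?ltr0n// ler_nat.
Qed.

Lemma cell_inj k l x : cell k x -> cell l x -> k = l.
Proof.
by move=> kx lx; case: (ltngtP k l) => // kl; have := cell_lt kl;
  [move=> /(_ _ _ kx lx)|move=> /(_ _ _ lx kx)]; rewrite ltxx.
Qed.

Lemma cell_exists x : 0 <= x < 1 -> exists2 k, (k < N)%N & cell k x.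
Proof.
move=> /andP[x0 x1]; have N0 : 0 < N%:R :> R by rewrite ltr0n.
have xN0 : 0 <= x * N%:R by rewrite mulr_ge0// ltW.
have := truncn_itv xN0; set k := Num.truncn _ => /andP[kx xk].
exists k; last by rewrite /cell /= in_itv /= ler_pdivrMr// kx ltr_pdivlMr.
by rewrite -(ltr_nat R); apply: (le_lt_trans kx); rewrite -[ltRHS]mul1r ltr_pM2r.
Qed.

Let length_cell (b : bool) k : lebesgue_measure
    [set` Interval (BSide b (k%:R / N%:R : R)) (BLeft (k.+1%:R / N%:R))] =
  (N%:R^-1)%:E :> \bar R.
Proof.
rewrite lebesgue_measure_itv /= lte_fin ltr_pM2r ?invr_gt0 ?ltr0n// ltr_nat ltnSn.
by rewrite -EFinD -mulrBl -natrB// subSnn mul1r.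
Qed.

Lemma lebesgue_measure_cell k :
  lebesgue_measure (cell k) = (N%:R^-1)%:E :> \bar R.
Proof. exact: length_cell. Qed.

(** The densities live on the open unit interval while the first cell contains
    [0]; intersecting loses a null set, since the open cell is still there. *)
Lemma integral_cell k : (k < N)%N ->
  (\int[lebesgue_measure]_(u in cell k `&` `]0%R, 1%R[) (1 : \bar R) = (N%:R^-1)%:E)%E.
Proof.
move=> kN; have N0 : 0 < N%:R :> R by rewrite ltr0n.
rewrite integral_cst/= ?mul1e; last by apply: measurableI; exact: measurable_itv.
apply/eqP; rewrite eq_le; apply/andP; split.
  rewrite -(length_cell true k); apply: le_measure; rewrite ?inE//=.
  by apply: measurableI; exact: measurable_itv.
rewrite -(length_cell false k); apply: le_measure; rewrite ?inE//=.
  by apply: measurableI; exact: measurable_itv.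
move=> x; rewrite /cell /= !in_itv /= => /andP[kx xk].
rewrite (ltW kx) xk (le_lt_trans _ kx) ?divr_ge0//; split => //.
by apply: (lt_le_trans xk); rewrite ler_pdivrMr// mul1r ler_nat.
Qed.
End grid.
Arguments cell R N k : clear implicits.

(** * The law of the cells visited *)
Section sigma_of.
Context d d' (T : measurableType d) (T' : measurableType d') (I : Type).
Variables (D : set I) (X : I -> T -> T').

Lemma sigma_of_preimage i B : D i -> measurable B -> sigma_of D X (X i @^-1` B).
Proof.
move=> Di mB; apply: sub_sigma_algebra; exists i => //.
by exists B; rewrite // setTI.
Qed.

Lemma sigma_of_measurable E :
  (forall i, D i -> measurable_fun [set: T] (X i)) -> sigma_of D X E -> measurable E.
Proof.
move=> mX; apply: smallest_sub; first exact: sigma_algebra_measurable.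
by move=> _ [i Di [B mB <-]]; exact: mX.
Qed.
End sigma_of.

Section grid_law.
Context (R : realType) d (T : measurableType d) (P : probability T R).
Context (theta : R) (U : nat -> {RV P >-> R}).
Hypothesis theta_gt0 : 0 < theta.
Hypothesis lawU : has_law_Ptheta theta U.

Let past n : set_system T := sigma_of `I_n.+1 (fun i => U i : T -> R).
Let M n w := running_min (fun i => U i w) n.

Let pastT n : measurableType _ := g_sigma_algebraType
  (\bigcup_(i in `I_n.+1) preimage_set_system [set: T] (U i : T -> R) measurable).

Let measurable_past n E : past n E -> measurable E.
Proof. by apply: sigma_of_measurable. Qed.

Let past_running_min n B : measurable B -> past n (M n @^-1` B).
Proof.
move=> mB; suff : forall m, (m <= n)%N -> measurable_fun [set: pastT n] (M m : pastT n -> R).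
  by move=> /(_ n (leqnn _)) /(_ measurableT B mB); rewrite setTI.
have mU i : (i <= n)%N -> measurable_fun [set: pastT n] (U i : pastT n -> R).
  by move=> ilen _ C mC; rewrite setTI; apply: sigma_of_preimage.
elim=> [_|m IH mlen].
  by rewrite (_ : M 0%N = U 0%N); [exact: mU|apply/funext => w; exact: running_min0].
rewrite (_ : M m.+1 = fun w => Num.min (M m w) (U m.+1 w)).
  by apply: measurable_minr; [apply: IH; exact: ltnW|exact: mU].
by apply/funext => w; exact: running_minS.
Qed.

Let measurable_running_min n : measurable_fun [set: T] (M n).
Proof.
by move=> _ B mB; rewrite setTI; apply: (@measurable_past n); exact: past_running_min.
Qed.

Variables (N : nat) (N_gt0 : (0 < N)%N).

Definition cell_event (c : nat -> nat) (n : nat) : set T :=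
  \bigcap_(i in `I_n) (U i @^-1` cell R N (c i)).

Lemma cell_eventS c n :
  cell_event c n.+1 = cell_event c n `&` U n @^-1` cell R N (c n).
Proof. by rewrite /cell_event !bigcap_mkord big_ord_recr. Qed.

Let past_cell_event c n : past n (cell_event c n.+1).
Proof.
rewrite /cell_event bigcap_mkord.
apply: (@bigsetI_measurable _ (pastT n) _ _ xpredT
  (fun i : 'I_n.+1 => U i @^-1` cell R N (c i))) => i _.
have : past n (U i @^-1` cell R N (c i))
  by apply: sigma_of_preimage; [exact: ltn_ord|exact: measurable_cell].
by [].
Qed.

(** Cells are ordered as their indices are, so the minimum lies in the
    lowest cell.  In the sequel records and minima of the terms can therefore be
    read off the cell indices [c]. *)
Lemma running_min_cell c n k w :
  running_min (fun i => (c i)%:R : R) n = k%:R -> cell_event c n.+1 w ->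
  cell R N k (M n w).
Proof.
move=> ck cw; have [i ilen ci] := running_min_mem (fun i => (c i)%:R : R) n.
have [j jlen Mj] := running_min_mem (fun i => U i w) n.
have /eqP := ci; rewrite ck eqr_nat => /eqP ki.
have : k%:R <= (c j)%:R :> R by rewrite -ck; exact: running_min_le.
rewrite ler_nat leq_eqVlt => /predU1P[->|kj].
  by rewrite /M Mj; exact: cw.
have ui : cell R N k (U i w) by rewrite ki; exact: cw.
have uj : cell R N (c j) (U j w) by exact: cw.
have := cell_lt N_gt0 kj ui uj; rewrite -Mj ltNge.
by rewrite running_min_le.
Qed.

Let mu_theta (A : set R) : \bar R := density_law (fun u => u `^ (theta - 1)) A.

Let density_lawZ (k : R) (f : R -> R) (A : set R) : measurable A ->
  measurable_fun [set: R] f -> (forall u, 0 <= f u) -> 0 <= k ->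
  (density_law (fun u => k * f u)%R A = k%:E * density_law f A)%E.
Proof.
move=> mA mf f0 k0; rewrite /density_law -ge0_integralZl//.
- by apply: measurableI => //; exact: measurable_itv.
- by apply/measurable_EFinP; exact: measurable_funTS.
- by move=> x _; rewrite lee_fin.
Qed.

(** Here the telescoping happens: the factor [r `^ (1 - theta)] of the next
    record cancels the density [r `^ (theta - 1)] that the current minimum [r]
    has on its cell, and what remains is the length of the cell. *)
Lemma integral_running_min_powR E n k (C : R) : 0 <= C -> (k < N)%N ->
  measurable E ->
  (forall A, measurable A ->
    P (E `&` M n @^-1` A) = (C%:E * mu_theta (A `&` cell R N k))%E) ->
  (\int[P]_(w in E) (M n w `^ (1 - theta))%:E = (C / N%:R)%:E)%E.
Proof.
move=> C0 kN mE PE.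
pose nu_ : {measure set R -> \bar R} := pushforward (mrestr P mE) (M n).
pose nu := nu_ (@measurable_running_min n).
pose g u : R := C * u `^ (theta - 1) * \1_(cell R N k `&` `]0%R, 1%R[) u.
have nuE A : measurable A -> nu A = (C%:E * mu_theta (A `&` cell R N k))%E.
  by move=> mA; rewrite -PE//= /pushforward /mrestr setIC.
have mck : measurable (cell R N k `&` `]0%R, 1%R[).
  by apply: measurableI; [exact: measurable_cell|exact: measurable_itv].
have mf : measurable_fun [set: R] (fun y : R => (y `^ (1 - theta))%:E).
  by apply/measurable_EFinP; exact: measurable_powR.
transitivity (\int[nu]_y (y `^ (1 - theta))%:E)%E.
  rewrite (@integral_density _ _ _ _ _ P nu (M n) \1_E)//; last 2 first.
  - move=> A mA; rewrite nuE// -PE// integral_indic//.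
    by apply: (@measurable_past n); exact: past_running_min.
  - by move=> y; rewrite lee_fin powR_ge0.
  rewrite [LHS]integral_mkcond; apply: eq_integral => w _.
  by rewrite /patch indicE; case: ifPn => _; rewrite ?mule1 ?mule0.
rewrite (@integral_density _ _ _ _ _ lebesgue_measure nu id g)//; last 4 first.
- apply: measurable_funM => //.
  by apply: measurable_funM => //; exact: measurable_powR.
- by move=> u; rewrite !mulr_ge0// ?powR_ge0.
- move=> A mA; rewrite nuE// /mu_theta -density_lawZ//; last 2 first.
  + by apply: measurableI => //; exact: measurable_cell.
  + by move=> u; rewrite powR_ge0.
  rewrite /density_law -setIA [LHS]integral_mkcond [RHS]integral_mkcond.
  apply: eq_integral => u _; rewrite /patch !in_setI /g indicE !in_setI.
  by case: (u \in A) => //=; case: ifP => _; rewrite ?mulr1 ?mulr0.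
- by move=> y; rewrite lee_fin powR_ge0.
rewrite EFinM -(integral_cell R N_gt0 kN) -ge0_integralZl//.
rewrite [RHS]integral_mkcond; apply: eq_integral => u _.
rewrite /patch /g indicE; case: ifPn => [|_]; last by rewrite mulr0 mule0.
rewrite in_setI => /andP[_]; rewrite inE /= in_itv /= => /andP[u0 _].
rewrite mule1 -EFinM mulr1 mulrCA -powRD.
  by rewrite addrC subrKA subrr powRr0 mulr1.
by rewrite (gt_eqF u0) implybT.
Qed.

Let density_law_record (r : R) (A : set R) : 0 < r -> measurable A ->
  (forall u, A u -> u < r) ->
  density_law (Ptheta_density theta r) A =
  ((theta * r `^ (1 - theta))%:E * mu_theta A)%E.
Proof.
move=> r0 mA Ar; rewrite /mu_theta -density_lawZ//; last 2 first.
- by move=> u; rewrite powR_ge0.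
- by rewrite mulr_ge0 ?powR_ge0// ltW.
apply: eq_integral => u; rewrite inE => -[/Ar ur].
rewrite /= in_itv /= => /andP[u0 _]; congr EFin.
rewrite /Ptheta_density ur leNgt ur /= mulr1 addr0 -mulrA; congr (_ * _).
rewrite powRM ?invr_ge0 ?ltW// mulrC -powR_inv1 ?ltW// -powRrM.
by rewrite mulN1r opprB.
Qed.

Let density_law_nonrecord (r : R) (A : set R) : measurable A -> (forall u, A u -> r <= u) ->
  density_law (Ptheta_density theta r) A =
  (\int[lebesgue_measure]_(u in A `&` `]0%R, 1%R[) (1 : \bar R))%E.
Proof.
move=> mA Ar; apply: eq_integral => u; rewrite inE => -[/Ar ru _].
by rewrite /Ptheta_density ltNge ru /= mulr0 add0r.
Qed.

(** The discrete form of the telescoped density.  The set [A] is there for the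
    induction: the next term depends on the past through the exact value of the
    minimum, not only through its cell.  A term in a higher cell
    contributes the length of its cell, and one in a lower cell contributes
    [theta] and takes over the role of the minimum, the former one
    being integrated out. *)
Theorem grid_law (c : nat -> nat) (n k : nat) :
  (forall i j, (i <= n)%N -> (j <= n)%N -> c i = c j -> i = j) ->
  (forall i, (i <= n)%N -> (c i < N)%N) ->
  running_min (fun i => (c i)%:R : R) n = k%:R ->
  forall A, measurable A ->
  P (cell_event c n.+1 `&` M n @^-1` A) =
  ((theta ^+ num_records (fun i => (c i)%:R : R) n.+1 / N%:R ^+ n)%:E *
   mu_theta (A `&` cell R N k))%E.
Proof.
have [U01 lawU0 lawUS] := lawU.
elim: n k => [|n IH] k cinj cN ck A mA.
  have M0 : M 0 = U 0%N by apply/funext => w; exact: running_min0.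
  rewrite M0 cell_eventS {1}/cell_event bigcap_mkord big_ord0 setTI.
  rewrite num_recordsS {1}/num_records big_ord0 is_lower_record0 expr0 divr1 expr1.
  move: ck; rewrite running_min0 => /eqP; rewrite eqr_nat => /eqP ->.
  rewrite -preimage_setI setIC.
  transitivity (distribution P (U 0%N) (A `&` cell R N k)) => //.
  rewrite lawU0; last first.
    by apply: measurableI => //; exact: measurable_cell.
  rewrite /mu_theta -density_lawZ//.
  - by apply: measurableI => //; exact: measurable_cell.
  - by move=> u; rewrite powR_ge0.
  - exact: ltW.
pose E := cell_event c n.+1.
have cinj' i j : (i <= n)%N -> (j <= n)%N -> c i = c j -> i = j.
  by move=> /leqW iltn /leqW jltn; exact: cinj.
have cN' i : (i <= n)%N -> (c i < N)%N by move=> /leqW; exact: cN.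
have [m mlen cm] := running_min_mem (fun i => (c i)%:R : R) n.
have {}IH := IH _ cinj' cN' cm.
rewrite -/E in IH.
have mE : measurable E by apply: (@measurable_past n); exact: past_cell_event.
have ck' := ck; rewrite running_minS in ck'.
rewrite cell_eventS num_recordsS is_lower_recordS -/E.
have step F B : past n F -> measurable B -> P (F `&` U n.+1 @^-1` B) =
    (\int[P]_(w in F) density_law (Ptheta_density theta (M n w)) B)%E.
  move=> pF mB; have [_ ->//] := lawUS n B mB.
  exact: sub_sigma_algebra.
(* As the cells are distinct, comparing cell indices decides whether the next
   term is a record. *)
rewrite cm in ck' *; have [rec|nrec] := ltP (c n.+1)%:R ((c m)%:R : R).
  move: ck'; rewrite min_r ?ltW// => /eqP; rewrite eqr_nat => /eqP kE.
  have cmn : (c n.+1 < c m)%N by rewrite -(ltr_nat R).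
  have M_gt w u : E w -> cell R N k u -> u < M n w.
    by rewrite -kE => Ew ku; apply: (cell_lt N_gt0 cmn ku); exact: running_min_cell Ew.
  have mAk : measurable (A `&` cell R N k).
    by apply: measurableI => //; exact: measurable_cell.
  have -> : E `&` U n.+1 @^-1` cell R N (c n.+1) `&` M n.+1 @^-1` A =
      E `&` U n.+1 @^-1` (A `&` cell R N k).
    apply/seteqP; split => w /= [].
      rewrite kE => -[Ew kw]; rewrite /M running_minS min_r => [//|].
      exact/ltW/M_gt.
    move=> Ew [Aw kw]; rewrite kE; split => //.
    by rewrite /M running_minS min_r//; exact/ltW/M_gt.
  rewrite step//; last exact: past_cell_event.
  have M_gt0 w : E w -> 0 < M n w.
    move=> Ew; have := running_min_cell cm Ew.
    rewrite /cell /= in_itv /= => /andP[+ _]; apply: lt_le_trans.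
    by rewrite divr_gt0 ?ltr0n// (leq_ltn_trans _ cmn).
  rewrite addn1 exprS.
  transitivity (\int[P]_(w in E)
    ((theta%:E * mu_theta (A `&` cell R N k)) * (M n w `^ (1 - theta))%:E))%E.
    apply: eq_integral => w; rewrite inE => Ew.
    rewrite density_law_record//; last 2 first.
    - exact: M_gt0.
    - by move=> u [_]; exact: M_gt.
    by rewrite EFinM muleAC.
  have mu_ge0 B : (0 <= mu_theta B)%E.
    by apply: integral_ge0 => u _; rewrite lee_fin powR_ge0.
  rewrite ge0_integralZl//; last 3 first.
  - apply: measurable_funTS; apply/measurable_EFinP.
    exact: (measurableT_comp (measurable_powR _)) (@measurable_running_min n).
  - by move=> w _; rewrite lee_fin powR_ge0.
  - by rewrite mule_ge0// lee_fin ltW.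
  rewrite (integral_running_min_powR _ _ _ IH)//; last 2 first.
  - by rewrite divr_ge0// exprn_ge0// ltW.
  - exact: cN'.
  rewrite muleAC -EFinM; congr (_ * _)%E; congr EFin.
  by rewrite exprS invfM; ring.
have jm : (c m < c n.+1)%N.
  rewrite ltn_neqAle -(ler_nat R) nrec andbT; apply/eqP => /cinj.
  by move=> /(_ (leqW mlen) (leqnn _)) e; rewrite e ltnn in mlen.
move: ck'; rewrite min_l// => /eqP; rewrite eqr_nat => /eqP kE.
have M_lt w u : E w -> cell R N (c n.+1) u -> M n w < u.
  by move=> Ew ku; apply: (cell_lt N_gt0 jm _ ku); exact: running_min_cell Ew.
have -> : E `&` U n.+1 @^-1` cell R N (c n.+1) `&` M n.+1 @^-1` A =
    E `&` M n @^-1` A `&` U n.+1 @^-1` cell R N (c n.+1).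
  rewrite [RHS]setIAC; apply/seteqP; split => w /= [[Ew kw] Aw]; split => //;
    by move: Aw; rewrite /M running_minS min_l//; exact/ltW/M_lt.
have pEA : past n (E `&` M n @^-1` A).
  apply: (@measurableI _ (pastT n)); [exact: past_cell_event|exact: past_running_min].
rewrite step//; last exact: measurable_cell.
under eq_integral.
  move=> w /[!inE] -[Ew _].
  rewrite density_law_nonrecord; last 2 first.
  - exact: measurable_cell.
  - by move=> u ku; exact/ltW/M_lt.
  rewrite integral_cell//; last exact: cN.
  over.
rewrite integral_cst//; last exact: (@measurable_past n).
rewrite addn0 exprS invfM (mulrC N%:R^-1) mulrA EFinM.
rewrite [in RHS](muleC _ (N%:R^-1)%:E) -muleA -kE.
exact: (congr1 (fun x => (N%:R^-1)%:E * x)%E (IH A mA)).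
Qed.
End grid_law.

(** * Distinct cells on a fine grid *)
Section distinct_cells.
Context (R : realType) d (T : measurableType d) (P : probability T R).
Context (theta : R) (U : nat -> {RV P >-> R}).
Hypothesis theta_gt0 : 0 < theta.
Hypothesis lawU : has_law_Ptheta theta U.

(** A bound for all the conditional densities at once.  Its singular term is the
    density of the first term, so integrability is free: that density has
    mass [1]. *)
Let g (u : R) : R := theta * u `^ (theta - 1) + (theta + 1).

Let measurable_g : measurable_fun [set: R] g.
Proof.
by apply: measurable_funD => //; apply: measurable_funM.
Qed.

(** Below [r] one has [u <= u / r <= 1].  The power of exponent [theta - 1] is
    at most [1] if [theta] is at least [1], and is otherwise decreasing. *)
Let Ptheta_density_le r u : 0 <= r <= 1 -> 0 < u < 1 -> Ptheta_density theta r u <= g u.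
Proof.
move=> /andP[r0 r1] /andP[u0 u1]; rewrite /Ptheta_density /g.
have p0 : 0 <= u `^ (theta - 1) by exact: powR_ge0.
have tp0 : 0 <= theta * u `^ (theta - 1) by rewrite mulr_ge0// ltW.
case: (ltP u r) => ur; last first.
  by rewrite /= mulr0 add0r addrA lerDr addr_ge0// ltW.
rewrite /= mulr1 addr0.
suff : (u / r) `^ (theta - 1) <= u `^ (theta - 1) + 1.
  by rewrite -(ler_pM2l theta_gt0) mulrDr; lra.
have r_gt0 : 0 < r by exact: lt_trans ur.
have ur1 : u / r <= 1 by rewrite ler_pdivrMr// mul1r ltW.
have uur : u <= u / r by rewrite ler_pdivlMr// ler_piMr// ltW.
case: (leP 1 theta) => theta1.
  apply: (@le_trans _ _ (1 `^ (theta - 1))); last by rewrite powR1 lerDr.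
  rewrite ge0_ler_powR ?subr_ge0// nnegrE ?ler01//.
  by rewrite divr_ge0// ltW.
apply: (@le_trans _ _ (u `^ (theta - 1))); last by rewrite lerDl.
rewrite -(opprB 1 theta) !powRN lef_pV2 ?posrE ?powR_gt0 ?divr_gt0//.
by rewrite ge0_ler_powR ?nnegrE ?subr_ge0 ?divr_ge0// ltW.
Qed.

Let measurable_Ptheta_density r : measurable_fun [set: R] (Ptheta_density theta r).
Proof.
rewrite (_ : Ptheta_density theta r = fun u => theta * (u / r) `^ (theta - 1) *
    \1_(`]-oo, r[ : set R) u + \1_(`[r, +oo[ : set R) u).
  apply: measurable_funD; last exact: measurable_indic.
  apply: measurable_funM; last exact: measurable_indic.
  apply: measurable_funM => //.
  by apply: (measurableT_comp (measurable_powR _)); exact: measurable_funM.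
by apply/funext => u; rewrite /Ptheta_density !indicE !mem_setE !in_itv/= andbT.
Qed.

(** Absolute continuity of the integral of [g]: short cells have small mass,
    uniformly in the current minimum and in the cell. *)
Lemma small_cells (e : R) : 0 < e -> exists2 N, (0 < N)%N &
  forall r k, 0 <= r <= 1 -> (density_law (Ptheta_density theta r) (cell R N k) <= e%:E)%E.
Proof.
move=> e0.
have [_ lawU0 _] := lawU.
pose f u := g u * \1_(`]0%R, 1%R[ : set R) u.
have mI : measurable (`]0%R, 1%R[ : set R) by exact: measurable_itv.
have intf : lebesgue_measure.-integrable [set: R] (EFin \o f).
  apply/integrableP; split.
    by apply/measurable_EFinP; apply: measurable_funM.
  under eq_integral.
    move=> u _; rewrite /= ger0_norm; last first.
      by rewrite /f /g mulr_ge0 ?addr_ge0 ?mulr_ge0 ?powR_ge0// ltW.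
    over.
  rewrite /= (_ : (\int[_]_x _)%E = (\int[lebesgue_measure]_(u in `]0%R, 1%R[) (g u)%:E)%E); last first.
    rewrite [RHS]integral_mkcond; apply: eq_integral => u _.
    by rewrite /patch /f indicE; case: ifP; rewrite ?mulr1 ?mulr0.
  rewrite /g; under eq_integral do rewrite EFinD.
  rewrite ge0_integralD//; last 3 first.
  - by move=> u _; rewrite lee_fin mulr_ge0 ?powR_ge0// ltW.
  - apply/measurable_EFinP; apply: measurable_funM => //.
    exact: measurable_funTS.
  - by move=> u _; rewrite lee_fin addr_ge0// ltW.
  rewrite integral_cst//= lebesgue_measure_itv/= lte01 -EFinB -EFinM lte_add_pinfty ?ltry//.
  have := lawU0 setT measurableT; rewrite /density_law setTI => <-.
  by rewrite (le_lt_trans (probability_le1 _ _))// ltry.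
have [dlt [d0 small]] := integral_normr_continuous intf e0.
have [N0 _ Nd] := near_infty_natSinv_lt (PosNum d0).
exists N0.+1 => // r k r01.
have mc : measurable (cell R N0.+1 k) by exact: measurable_cell.
have {}small : \int[lebesgue_measure]_(x in cell R N0.+1 k) `|f x| < e.
  apply: (small _ mc); apply: (@le_lt_trans _ _ (N0.+1%:R^-1)%:E).
    by rewrite -(lebesgue_measure_cell R (ltn0Sn N0) k).
  by rewrite lte_fin; exact: (Nd N0 (leqnn _)).
have fin : (\int[lebesgue_measure]_(x in cell R N0.+1 k) (`|f x|)%:E)%E \is a fin_num.
  apply: integrable_fin_num => //.
  by apply: (integrableS measurableT) => //; exact: integrable_norm.
apply: (@le_trans _ _ (\int[lebesgue_measure]_(x in cell R N0.+1 k) (`|f x|)%:E)%E).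
  rewrite /density_law [leRHS](_ : _ =
    \int[lebesgue_measure]_(x in cell R N0.+1 k `&` `]0%R, 1%R[) (g x)%:E)%E.
    apply: ge0_le_integral => //.
    - exact: measurableI.
    - move=> u _; rewrite lee_fin /Ptheta_density.
      by rewrite addr_ge0 ?mulr_ge0 ?powR_ge0 ?ler0n// ltW.
    - by apply/measurable_EFinP; apply: measurable_funTS; exact: measurable_Ptheta_density.
    - by apply/measurable_EFinP; apply: measurable_funTS; exact: measurable_g.
    - move=> u [_]; rewrite /= in_itv /= => u01; rewrite lee_fin.
      exact: Ptheta_density_le.
  rewrite integral_mkcondr; apply: eq_integral => u _.
  rewrite /patch /f indicE; case: ifP => _; rewrite ?mulr1 ?mulr0 ?normr0//.
  by rewrite ger0_norm// /g !addr_ge0 ?mulr_ge0 ?powR_ge0// ltW.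
by rewrite -(fineK fin) lee_fin; exact: ltW.
Qed.

Let density_law1 f : density_law f [set 1 : R] = 0%E.
Proof.
rewrite /density_law (_ : _ `&` _ = set0) ?integral_set0//.
by apply/seteqP; split => // u /= [-> ]; rewrite in_itv /= ltxx andbF.
Qed.

(** The half-open cells do not contain the point [1]. *)
Lemma U_eq1 i : P (U i @^-1` [set 1]) = 0%E.
Proof.
have [_ lawU0 lawUS] := lawU; case: i => [|i].
  by have := lawU0 _ (measurable_set1 (1 : R)); rewrite density_law1.
have [_ /(_ setT)] := lawUS i _ (measurable_set1 (1 : R)).
rewrite setTI => ->.
  by under eq_integral do rewrite density_law1; rewrite integral0.
exact: (@measurableT _ (g_sigma_algebraType _)).
Qed.

(** Whichever cell [U i] occupies, the later [U j] falls into it with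
    conditional probability at most [e]. *)
Lemma same_cell_le N (e : R) i j : (i < j)%N -> (0 < N)%N -> 0 <= e ->
  (forall r k, 0 <= r <= 1 ->
    (density_law (Ptheta_density theta r) (cell R N k) <= e%:E)%E) ->
  (P (\bigcup_(k : 'I_N) (U i @^-1` cell R N k `&` U j @^-1` cell R N k)) <= e%:E)%E.
Proof.
case: j => // j; rewrite ltnS => ij N0 e0 small; have [U01 _ lawUS] := lawU.
have mU l (k : 'I_N) : measurable (U l @^-1` cell R N k).
  by apply: measurable_funPTI; exact: measurable_cell.
apply: (le_trans (measure_bigcup_finType_le _ _)) => [k|].
  by apply: measurableI; exact: mU.
apply: (@le_trans _ _ (\sum_(k < N) e%:E * P (U i @^-1` cell R N k)))%E.
  apply: lee_sum => k _.
  have [mk PE] := lawUS j _ (@measurable_cell R N k).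
  rewrite [leLHS](PE (U i @^-1` cell R N k)); last first.
    by apply: sub_sigma_algebra; apply: sigma_of_preimage => //; exact: measurable_cell.
  rewrite -[leRHS]integral_cst; last exact: mU.
  apply: ge0_le_integral => //.
  - move=> w _; apply: integral_ge0 => u _; rewrite lee_fin /Ptheta_density.
    by rewrite addr_ge0 ?mulr_ge0 ?powR_ge0 ?ler0n// ltW.
  - apply: measurable_funTS => _ B mB; have := mk measurableT B mB.
    rewrite !setTI => h.
    suff : <<s sigma_of `I_j.+1 (fun i => U i : T -> R)>> `<=` measurable by exact.
    apply: smallest_sub; first exact: sigma_algebra_measurable.
    by move=> E; apply: sigma_of_measurable.
  - move=> w _; apply: small.
    have [l _ Ml] := running_min_mem (fun i => U i w) j.
    by rewrite -[X in 0 <= X <= 1]/(running_min (fun i => U i w) j) Ml.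
rewrite -ge0_sume_distrr// -measure_bigcup_finType//; last first.
  move=> k l _ _ [w [/= wk wl]]; apply/val_inj; exact: cell_inj wk wl.
rewrite -[leRHS]mule1; apply: lee_wpmul2l; first by rewrite lee_fin.
apply: probability_le1; rewrite bigcup_finType.
exact: bigsetU_measurable.
Qed.

(** The exceptional set [F] collects the values [1] and the pairs of terms in a
    common cell. *)
Lemma distinct_cells (n : nat) (e : R) : 0 < e -> exists2 N, (0 < N)%N &
  exists2 F : set T, measurable F /\ (P F <= e%:E)%E &
  forall w, ~ F w -> exists c : nat -> nat,
    [/\ forall i, (i < n)%N -> (c i < N)%N,
        forall i, (i < n)%N -> cell R N (c i) (U i w) &
        forall i j, (i < n)%N -> (j < n)%N -> c i = c j -> i = j].
Proof.
(* There are at most n * n pairs of indices; the successor keeps the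
   denominator positive. *)
move=> e0; pose e1 := e / (n * n).+1%:R.
have e1_gt0 : 0 < e1 by rewrite divr_gt0.
have [N N0 small] := small_cells e1_gt0; exists N => //.
have mU l (k : nat) : measurable (U l @^-1` cell R N k).
  by apply: measurable_funPTI; exact: measurable_cell.
have mU1 l : measurable (U l @^-1` [set 1]) by exact: measurable_funPTI.
pose S (i j : nat) := if (i < j)%N then
  \bigcup_(k : 'I_N) (U i @^-1` cell R N k `&` U j @^-1` cell R N k) else set0.
have mS i j : measurable (S i j).
  rewrite /S; case: ifP => // _; rewrite bigcup_finType.
  by apply: bigsetU_measurable => k _; exact: measurableI.
have PS i j : (P (S i j) <= e1%:E)%E.
  rewrite /S; case: ifP => [ij|_]; last by rewrite measure0 lee_fin ltW.
  by apply: same_cell_le => //; exact: ltW.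
have mF1 : measurable (\bigcup_(i : 'I_n) (U i @^-1` [set 1])).
  by rewrite bigcup_finType; exact: bigsetU_measurable.
have mF2 : measurable (\bigcup_(p : 'I_n * 'I_n) S p.1 p.2).
  by rewrite bigcup_finType; exact: bigsetU_measurable.
exists (\bigcup_(i : 'I_n) (U i @^-1` [set 1]) `|` \bigcup_(p : 'I_n * 'I_n) S p.1 p.2).
  split; first exact: measurableU.
  apply: (le_trans (measureU2 _ mF1 mF2)); rewrite -[leRHS]add0e; apply: leeD.
    apply: (le_trans (measure_bigcup_finType_le _ _)) => //.
    by rewrite big1// => i _; exact: U_eq1.
  apply: (le_trans (measure_bigcup_finType_le _ _)) => //.
  apply: (@le_trans _ _ (\sum_(p : 'I_n * 'I_n) e1%:E)%E).
    by apply: lee_sum => p _; exact: PS.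
  rewrite sumEFin lee_fin big_const iter_addr_0 card_prod card_ord -[leLHS]mulr_natr /e1.
  rewrite mulrAC ler_pdivrMr// ler_pM2l// ler_nat.
  exact: leqnSn.
move=> w /not_orP[w1 wS].
have [U01 _ _] := lawU.
have cellU i : (i < n)%N -> exists2 k, (k < N)%N & cell R N k (U i w).
  move=> ilen; apply: cell_exists => //; have /andP[-> /=] := U01 i w.
  rewrite le_eqVlt => /predU1P[Ui|//].
  by exfalso; apply: w1; exists (Ordinal ilen).
pose c i := if pselect (exists k, (k < N)%N /\ cell R N k (U i w)) is left h
  then projT1 (cid h) else 0%N.
have cP i : (i < n)%N -> (c i < N)%N /\ cell R N (c i) (U i w).
  move=> /cellU[k kN ck]; rewrite /c; case: pselect => [h|[]]; last by exists k.
  exact: (projT2 (cid h)).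
exists c; split => [i /cP[]//|i /cP[]//|].
have inj i j : (i < j)%N -> (j < n)%N -> c i <> c j.
  move=> ij jn cij; have iltn := ltn_trans ij jn; apply: wS.
  exists (Ordinal iltn, Ordinal jn) => //=; rewrite /S ij.
  have [ciN ci] := cP _ iltn; exists (Ordinal ciN) => //=; split => //.
  by rewrite cij; exact: (cP _ jn).2.
move=> i j iltn jltn cij; case: (ltngtP i j) => // ij.
  by have := inj _ _ ij jltn cij.
by have := inj _ _ ij iltn (esym cij).
Qed.
End distinct_cells.

(** * Order patterns *)
Section order_patterns.
Context (R : realType).
Implicit Types u v : nat -> R.

Definition same_order u v n := forall i j, (i < n)%N -> (j < n)%N ->
  (u i <= u j) = (v i <= v j).

Lemma same_order_sym u v n : same_order u v n -> same_order v u n.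
Proof. by move=> h i j iltn jltn; rewrite h. Qed.

Lemma same_order_trans u v x n :
  same_order u v n -> same_order v x n -> same_order u x n.
Proof. by move=> uv vx i j iltn jltn; rewrite uv// vx. Qed.

Lemma same_order_lt u v n i j : same_order u v n -> (i < n)%N -> (j < n)%N ->
  (u i < u j) = (v i < v j).
Proof. by move=> uv iltn jltn; rewrite !ltNge uv. Qed.

Lemma same_order_record u v n i : same_order u v n -> (i < n)%N ->
  is_lower_record u i = is_lower_record v i.
Proof.
move=> uv iltn; apply: eq_forallb => j; apply: (same_order_lt uv) => //.
exact: ltn_trans iltn.
Qed.

Lemma same_order_num_records u v n : same_order u v n ->
  num_records u n = num_records v n.
Proof.
by move=> uv; apply: eq_bigr => i _; rewrite (same_order_record uv).
Qed.

(** Order patterns are represented by permutations, read as real sequences so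
    that the notions defined for sequences (records, [perm_pi]) apply to
    them. *)
Definition perm_seq n (q : {perm 'I_n.+1}) (i : nat) : R := (q (inord i) : nat)%:R.

Lemma perm_seqE n (q : {perm 'I_n.+1}) (i : 'I_n.+1) : perm_seq q i = (q i : nat)%:R.
Proof. by rewrite /perm_seq inord_val. Qed.

Definition rank u n (i : 'I_n) : nat := #|[set j : 'I_n | u j < u i]%SET|.

Lemma rank_lt u n (i : 'I_n) : (rank u i < n)%N.
Proof.
rewrite -[ltnRHS]card_ord -cardsT; apply/proper_card/properP.
by split; [exact: finset.subsetT|exists i; rewrite inE// ltxx].
Qed.

(** The sets of terms below a given one are nested, strictly so when the values
    differ. *)
Lemma le_rank u n (i j : 'I_n) : (rank u i <= rank u j)%N = (u i <= u j).
Proof.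
case: (leP (u i) (u j)) => uij.
  apply/subset_leq_card/fintype.subsetP => k; rewrite !inE => /lt_le_trans; exact.
apply/negbTE; rewrite -ltnNge; apply/proper_card/properP; split.
  by apply/fintype.subsetP => k; rewrite !inE => /lt_trans; exact.
by exists j; rewrite inE ?uij// ltxx.
Qed.

Lemma rank_perm n (q : {perm 'I_n.+1}) (i : 'I_n.+1) :
  rank (perm_seq q) i = q i.
Proof.
rewrite /rank -sum1dep_card (reindex_perm q^-1%g) /=.
under eq_bigl do rewrite !perm_seqE permKV ltr_nat.
rewrite -(big_ord_widen _ (fun=> 1%N)); last exact: ltnW.
by rewrite sum_nat_const card_ord muln1.
Qed.

Lemma same_order_perm_inj n (q q' : {perm 'I_n.+1}) :
  same_order (perm_seq q) (perm_seq q') n.+1 -> q = q'.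
Proof.
move=> qq'; apply/permP => i; apply/val_inj => /=; rewrite -!rank_perm.
by apply: eq_card => j; rewrite !inE (same_order_lt qq').
Qed.

(** The pattern of a sequence with distinct terms is the permutation of its
    ranks. *)
Lemma exists_pattern u n :
  (forall i j, (i <= n)%N -> (j <= n)%N -> u i = u j -> i = j) ->
  exists q : {perm 'I_n.+1}, same_order u (perm_seq q) n.+1.
Proof.
move=> uinj.
pose f i : 'I_n.+1 := Ordinal (rank_lt u i).
have finj : injective f.
  move=> i j /(congr1 val)/= rij; apply/val_inj.
  have ord_le (k : 'I_n.+1) : (k <= n)%N by exact: ltn_ord k.
  apply: (uinj i j) => //.
  by apply/eqP; rewrite eq_le -!le_rank rij leqnn.
exists (perm finj) => i j iltn jltn.
rewrite -[i]/(val (Ordinal iltn)) -[j]/(val (Ordinal jltn)) -le_rank.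
by rewrite !perm_seqE ler_nat !permE.
Qed.

End order_patterns.

(** * The law of the order pattern *)
Section pattern_law.
Context (R : realType) d (T : measurableType d) (P : probability T R).
Context (theta : R) (U : nat -> {RV P >-> R}).
Hypothesis theta_gt0 : 0 < theta.
Hypothesis lawU : has_law_Ptheta theta U.
Variable n : nat.

Definition pattern_event (q : {perm 'I_n.+1}) : set T :=
  [set w | same_order (fun i => U i w) (perm_seq R q) n.+1].

Lemma measurable_pattern_event q : measurable (pattern_event q).
Proof.
rewrite (_ : pattern_event q = \bigcap_(ij in [set: 'I_n.+1 * 'I_n.+1])
   [set w | (U ij.1 w <= U ij.2 w) = (perm_seq R q ij.1 <= perm_seq R q ij.2)]).
  apply: fin_bigcap_measurable => // ij _.
  have := @measurable_fun_ler _ T R setT (U ij.1) (U ij.2) (measurable_funPT _) (measurable_funPT _).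
  by move=> /(_ measurableT [set (perm_seq R q ij.1 <= perm_seq R q ij.2)] I); rewrite setTI.
apply/seteqP; split => w /=.
  by move=> h ij _ /=; apply: h.
by move=> h i j iltn jltn; exact: (h (Ordinal iltn, Ordinal jltn)).
Qed.

Lemma trivIset_pattern_event : trivIset [set: {perm 'I_n.+1}] pattern_event.
Proof.
move=> q q' _ _ [w [wq wq']]; apply: (@same_order_perm_inj R).
exact: (same_order_trans (same_order_sym wq) wq').
Qed.

Let Z : R := \sum_(q : {perm 'I_n.+1}) theta ^+ num_records (perm_seq R q) n.+1.

Let Z_gt0 : 0 < Z.
Proof.
rewrite /Z (bigD1 1%g)//=; apply: ltr_pwDl; first exact: exprn_gt0.
by apply: sumr_ge0 => q _; rewrite exprn_ge0// ltW.
Qed.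

Section grid.
Variables (N : nat) (N_gt0 : (0 < N)%N).

(** The cells occupied by the terms, listed from bottom to top, form an
    increasing function [e], and the term of index [i] occupies the cell of index
    [e (q i)] when [q] is the pattern.  Splitting according to [e] separates the
    set of cells from their arrangement. *)
Let incr := {e : {ffun 'I_n.+1 -> 'I_N} |
  [forall i : 'I_n.+1, forall j : 'I_n.+1, ((i < j)%N ==> (e i < e j)%N)]}.

Let cells (e : incr) (q : {perm 'I_n.+1}) (i : nat) : nat := val e (q (inord i)).

Let incrP (e : incr) (i j : 'I_n.+1) : (val e i < val e j)%N = (i < j)%N.
Proof.
have h (k l : 'I_n.+1) : (k < l)%N -> (val e k < val e l)%N.
  by have /forallP/(_ k)/forallP/(_ l)/implyP := valP e.
case: (ltngtP i j) => [/h //|/h /ltnW|/val_inj ->]; last by rewrite ltnn.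
by rewrite leqNgt => /negbTE.
Qed.

(** The part of the pattern event which the grid sees: the terms are in distinct
    cells, arranged as in [q]. *)
Let G (q : {perm 'I_n.+1}) : set T := \bigcup_(e : incr) cell_event U N (cells e q) n.+1.

Let measurable_cell_event c : measurable (cell_event U N c n.+1).
Proof.
rewrite /cell_event; apply: fin_bigcap_measurable => // k _.
by apply: measurable_funPTI; exact: measurable_cell.
Qed.

Let G_pattern q : G q `<=` pattern_event q.
Proof.
move=> w [e _ ew] i j iltn jltn.
have cellsP k l : (k < n.+1)%N -> (l < n.+1)%N -> perm_seq R q k < perm_seq R q l ->
    U k w < U l w.
  move=> kn ln; rewrite /perm_seq ltr_nat -(incrP e) => kl.
  by apply: (cell_lt N_gt0 kl); [exact: (ew k kn)|exact: (ew l ln)].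
case: (ltgtP (perm_seq R q i) (perm_seq R q j)) => [/cellsP h|/cellsP h|].
- by rewrite ltW// h.
- by apply/negbTE; rewrite -ltNge h.
- move/eqP; rewrite /perm_seq eqr_nat => /eqP/val_inj/perm_inj/(congr1 val) /=.
  by rewrite !inordK// => ->; rewrite lexx.
Qed.

(** The lowest cell is [e ord0] whatever [q] is, and [e] preserves records; so
    the arrangement [q] enters only through its number of records. *)
Let PG q : P (G q) = ((theta ^+ num_records (perm_seq R q) n.+1)%:E *
  \sum_(e : incr) (N%:R ^- n)%R%:E *
    density_law (fun u => u `^ (theta - 1))%R (cell R N (val e ord0)))%E.
Proof.
rewrite /G measure_bigcup_finType//; last first.
  move=> e e' _ _ [w [ew ew']]; apply/val_inj/ffunP => i; apply/val_inj.
  have kn : (q^-1%g i < n.+1)%N by [].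
  have := cell_inj N_gt0 (ew _ kn) (ew' _ kn).
  by rewrite /cells inord_val permKV.
rewrite ge0_sume_distrr; last first.
  move=> e _; rewrite mule_ge0// ?lee_fin ?invr_ge0 ?exprn_ge0//.
  by apply: integral_ge0 => u _; rewrite lee_fin powR_ge0.
apply: eq_bigr => e _.
have same : same_order (fun i => (cells e q i)%:R : R) (perm_seq R q) n.+1.
  by move=> i j _ _; rewrite /perm_seq !ler_nat leqNgt incrP -leqNgt.
have min0 : running_min (fun i => (cells e q i)%:R : R) n = (val e ord0)%:R.
  apply/eqP; rewrite eq_le; apply/andP; split.
    have := @running_min_le R (fun i => (cells e q i)%:R : R) n (q^-1%g ord0).
    by rewrite {2}/cells inord_val permKV; apply; rewrite -ltnS.
  apply: le_running_min => i _; rewrite ler_nat leqNgt incrP.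
  by rewrite ltn0.
have := grid_law theta_gt0 lawU N_gt0 _ _ min0 measurableT.
rewrite preimage_setT setIT setTI (same_order_num_records same) EFinM -muleA; apply.
- move=> i j ilen jlen /val_inj ee; suff : q (inord i) = q (inord j).
    by move=> /perm_inj/(congr1 val) /=; rewrite !inordK.
  apply/val_inj; case: (ltngtP (q (inord i)) (q (inord j))) => //;
    by rewrite -(incrP e) ee ltnn.
- by move=> i _; exact: ltn_ord.
Qed.

Let s : \bar R := (\sum_(e : incr) (N%:R ^- n)%R%:E *
    density_law (fun u => u `^ (theta - 1))%R (cell R N (val e ord0)))%E.

(** The singularity of [u `^ (theta - 1)] at [0] is integrable because [s] is,
    up to a positive factor, a probability. *)
Let s_fin : s \is a fin_num.
Proof.
have s0 : (0 <= s)%E.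
  apply: sume_ge0 => e _; rewrite mule_ge0// ?lee_fin ?invr_ge0 ?exprn_ge0//.
  by apply: integral_ge0 => u _; rewrite lee_fin powR_ge0.
rewrite ge0_fin_numE// ltNge leye_eq; apply/eqP => sy.
have := PG 1%g; rewrite -/s sy gt0_muley ?lte_fin ?exprn_gt0// => PGy.
have : (P (G 1%g) <= 1)%E.
  by apply: probability_le1; rewrite /G bigcup_finType; exact: bigsetU_measurable.
by rewrite PGy.
Qed.

(** The probabilities [P (G q) = theta ^+ K(q) * s] sum to [Z * s], which is at
    least [1 - e] as the sets [G q] cover the complement of [F]; hence
    [s >= (1 - e) / Z]. *)
Lemma pattern_law_ge (e : R) (F : set T) : measurable F -> (P F <= e%:E)%E ->
  (forall w, ~ F w -> exists c : nat -> nat,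
    [/\ forall i, (i < n.+1)%N -> (c i < N)%N,
        forall i, (i < n.+1)%N -> cell R N (c i) (U i w) &
        forall i j, (i < n.+1)%N -> (j < n.+1)%N -> c i = c j -> i = j]) ->
  forall q, ((theta ^+ num_records (perm_seq R q) n.+1 * ((1 - e) / Z))%:E <=
    P (pattern_event q))%E.
Proof.
move=> mF Fe Fcells q.
have mG q' : measurable (G q').
  by rewrite /G bigcup_finType; exact: bigsetU_measurable.
apply: (@le_trans _ _ (P (G q))); last first.
  apply: le_measure; rewrite ?inE//.
  exact: measurable_pattern_event.
rewrite PG -/s EFinM; apply: lee_wpmul2l; first by rewrite lee_fin exprn_ge0// ltW.
rewrite -(fineK s_fin) lee_fin ler_pdivrMr// -lee_fin mulrC EFinM fineK//.
have cover : ~` F `<=` \bigcup_q' G q'.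
  move=> w /Fcells[c [cN cU cinj]].
  have cU_lt i j : (i < n.+1)%N -> (j < n.+1)%N -> U i w < U j w -> (c i < c j)%N.
    move=> iltn jltn Uij; case: (ltngtP (c i) (c j)) => // cij.
      by have := cell_lt N_gt0 cij (cU _ jltn) (cU _ iltn); rewrite ltNge (ltW Uij).
    by move: Uij; rewrite (cinj _ _ iltn jltn cij) ltxx.
  have [|q' wq'] := @exists_pattern R (fun i => U i w) n.
    move=> i j iltn jltn Uij; apply: cinj => //.
    by apply: (cell_inj N_gt0 (cU _ iltn)); rewrite Uij; exact: cU.
  pose f := [ffun k : 'I_n.+1 => Ordinal (cN _ (ltn_ord (q'^-1%g k)))].
  have finc : [forall i : 'I_n.+1, forall j : 'I_n.+1, ((i < j)%N ==> (f i < f j)%N)].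
    apply/forallP => i; apply/forallP => j; apply/implyP => ij.
    rewrite !ffunE /=; apply: cU_lt => //.
    by rewrite (same_order_lt wq')// !perm_seqE !permKV ltr_nat.
  exists q' => //; exists (exist _ f finc) => // i iltn /=.
  by rewrite /cells /= ffunE /= permK inordK//; exact: cU.
apply: (@le_trans _ _ (P (~` F))).
  by rewrite probability_setC// EFinB leeB.
apply: (@le_trans _ _ (P (\bigcup_q' G q'))).
  apply: le_measure; rewrite ?inE//; first exact: measurableC.
  by rewrite bigcup_finType; exact: bigsetU_measurable.
apply: (le_trans (measure_bigcup_finType_le _ _)) => //.
rewrite /Z -sumEFin ge0_sume_distrl; last by move=> ? _; rewrite lee_fin exprn_ge0// ltW.
by apply: lee_sum => q' _; rewrite [leLHS]PG.
Qed.
End grid.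

(** As [e] tends to [0] the lower bounds become [theta ^+ K(q) / Z].  They sum to
    [1] and the pattern events are disjoint, so none of the inequalities is
    strict. *)
Theorem pattern_law q : P (pattern_event q) =
  (theta ^+ num_records (perm_seq R q) n.+1 / Z)%:E.
Proof.
have Pfin q' : P (pattern_event q') \is a fin_num.
  by apply: fin_num_measure; exact: measurable_pattern_event.
pose a q' := fine (P (pattern_event q')).
pose b (q' : {perm 'I_n.+1}) : R := theta ^+ num_records (perm_seq R q') n.+1 / Z.
have b_gt0 q' : 0 < b q' by rewrite divr_gt0// ?exprn_gt0//.
have ba q' : b q' <= a q'.
  apply/ler_addgt0Pr => e e0; rewrite -lerBlDr.
  (* The factor 1 - e / b q' lowers the bound b q' by exactly e. *)
  have eb : 0 < e / b q' by exact: divr_gt0.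
  have [N N0 [F [mF PF] FP]] := distinct_cells theta_gt0 lawU n.+1 eb.
  have := pattern_law_ge N0 mF PF FP q'.
  rewrite -(fineK (Pfin _)) lee_fin; apply: le_trans.
  rewrite mulrCA -[X in _ <= _ * X]/(b q') mulrBl mul1r divfK//.
  by rewrite gt_eqF.
have a1 : \sum_q' a q' <= 1.
  rewrite -lee_fin -sumEFin; under eq_bigr do rewrite fineK//.
  rewrite -measure_bigcup_finType//; last 2 first.
  - by move=> q'; exact: measurable_pattern_event.
  - exact: trivIset_pattern_event.
  apply: probability_le1; rewrite bigcup_finType.
  by apply: bigsetU_measurable => q' _; exact: measurable_pattern_event.
have b1 : \sum_q' b q' = 1 by rewrite -mulr_suml divff// gt_eqF.
have : \sum_q' (a q' - b q') == 0.
  rewrite eq_le sumrB b1 subr_le0 a1/=.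
  by rewrite -b1 -sumrB sumr_ge0// => q' _; rewrite subr_ge0.
rewrite psumr_eq0; last by move=> q' _; rewrite subr_ge0.
move=> /allP/(_ q); rewrite mem_index_enum subr_eq0 => /(_ isT) /eqP ab.
by rewrite -[RHS]/((b q)%:E) -ab /a fineK.
Qed.
End pattern_law.

(** * Marks, blocks and spacings *)
Section marks.
Variable p : nat -> bool.
Hypothesis p0 : p 0%N.

(** A set [p] of marks containing [0] cuts the indices into blocks, each starting
    at a mark.  The marks are used both for the records, where [last_mark] is
    [last_record], and for the block starts of the Feller coupling. *)
Definition last_mark (i : nat) : nat := (\max_(j < i.+1 | p j) j)%N.

Lemma last_mark_le i : (last_mark i <= i)%N.
Proof. by apply/bigmax_leqP => j _; rewrite -ltnS. Qed.

Lemma last_markP i : p (last_mark i).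
Proof.
have pi0 : p (@ord0 i) by [].
by rewrite /last_mark (bigop.bigmax_eq_arg ord0)//; case: arg_maxnP.
Qed.

Lemma last_mark_max i j : p j -> (j <= i)%N -> (j <= last_mark i)%N.
Proof.
move=> pj ji; have ji' : (j < i.+1)%N by [].
by apply: (@leq_bigmax_cond _ (fun k : 'I_i.+1 => p k)
  (fun k : 'I_i.+1 => k : nat) (Ordinal ji')).
Qed.

Lemma last_mark_id i : p i -> last_mark i = i.
Proof.
by move=> pi; apply/eqP; rewrite eqn_leq last_mark_le last_mark_max.
Qed.

Lemma last_markS i : ~~ p i.+1 -> last_mark i.+1 = last_mark i.
Proof.
move=> pi; apply/eqP; rewrite eqn_leq; apply/andP; split.
  apply: last_mark_max; first exact: last_markP.
  have := last_mark_le i.+1; rewrite leq_eqVlt => /predU1P[e|//].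
  by move: pi; rewrite -e last_markP.
by apply: last_mark_max; [exact: last_markP|rewrite leqW// last_mark_le].
Qed.

Lemma last_mark_eq a k i : p a -> (forall j, (a < j < k)%N -> ~~ p j) ->
  (a <= i < k)%N -> last_mark i = a.
Proof.
move=> pa nop /andP[ai ik]; apply/eqP; rewrite eqn_leq last_mark_max// andbT.
rewrite leqNgt; apply/negP => h; have := nop (last_mark i).
by rewrite h (leq_ltn_trans (last_mark_le i))// last_markP => /(_ isT).
Qed.

Lemma count_last_mark n a k : p a -> (a < k <= n)%N ->
  (forall j, (a < j < k)%N -> ~~ p j) -> (k < n)%N ==> p k ->
  count (fun i => last_mark i == a) (iota 0 n) = (k - a)%N.
Proof.
move=> pa /andP[ak kn] nop pk.
have -> : n = (a + ((k - a) + (n - k)))%N by rewrite addnA subnKC ?subnKC// ltnW.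
rewrite !iotaD !count_cat add0n (subnKC (ltnW ak)).
rewrite [X in (X + _)%N](_ : _ = 0%N) ?add0n; last first.
  apply/eqP; rewrite -leqn0 leqNgt -has_count; apply/hasPn => i.
  rewrite mem_iota add0n /= => ia; apply/eqP => e.
  by move: ia; rewrite -e ltnNge last_mark_le.
rewrite [X in (_ + X)%N](_ : _ = 0%N) ?addn0; last first.
  apply/eqP; rewrite -leqn0 leqNgt -has_count; apply/hasPn => i.
  rewrite mem_iota subnKC// => /andP[ki iltn]; apply/eqP => e.
  have : (k <= last_mark i)%N.
    by apply: last_mark_max => //; move/implyP: pk; apply; exact: leq_ltn_trans iltn.
  by rewrite e leqNgt ak.
rewrite -[RHS](size_iota a); apply/eqP; rewrite -all_count; apply/allP => i.
rewrite mem_iota (subnKC (ltnW ak)) => aik; apply/eqP.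
exact: last_mark_eq aik.
Qed.

(** The spacing between two consecutive marks is the length of the block that
    the first one starts; the mark at [n] ends the last block.  Lengths are
    written as counts of indices, the form in which cycle lengths arise. *)
Lemma spacings_marks n : (0 < n)%N -> p n ->
  spacings (mkseq p n.+1) =
  [seq count (fun i => last_mark i == a) (iota 0 n) | a <- iota 0 n & p a].
Proof.
case: n => // n _ pn; rewrite /spacings size_mkseq.
have -> : [seq i <- iota 0 n.+2 | nth false (mkseq p n.+2) i] =
    0%N :: rcons [seq i <- iota 1 n | p i] n.+1.
  rewrite (eq_in_filter (a2 := p)); last first.
    by move=> i; rewrite mem_iota /= => iltn; rewrite nth_mkseq.
  by rewrite -addn1 iotaD filter_cat /= p0 pn cats1.
have -> : [seq a <- iota 0 n.+1 | p a] = 0%N :: [seq i <- iota 1 n | p i].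
  by rewrite /= p0.
suff gen N a k m : p a -> (a < k)%N -> (forall j, (a < j < k)%N -> ~~ p j) ->
    (k + m)%N = N ->
    pairmap (fun x y => y - x)%N a (rcons [seq i <- iota k m | p i] N) =
    [seq count (fun i => last_mark i == c) (iota 0 N) |
      c <- a :: [seq i <- iota k m | p i]].
  by rewrite [LHS]/= (gen n.+1 0%N 1%N)// => -[].
move=> pa ak nop kmn.
elim: m => [|m IH] in a k pa ak nop kmn *.
  rewrite addn0 in kmn; rewrite -kmn /=.
  by rewrite (@count_last_mark k a k)// ?ak ?leqnn ?ltnn.
have kn : (k < N)%N by rewrite -kmn -addSnnS leq_addr.
have kmn' : (k.+1 + m)%N = N by rewrite addSnnS.
have -> : [seq i <- iota k m.+1 | p i] =
    if p k then k :: [seq i <- iota k.+1 m | p i] else [seq i <- iota k.+1 m | p i].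
  by [].
case: ifPn => [pk|npk].
  rewrite rcons_cons [LHS]/= [RHS]/=; congr (_ :: _).
    by rewrite (@count_last_mark N a k)// ?ak ?(ltnW kn)// pk implybT.
  rewrite IH// => j; case/andP; rewrite ltnS => h1 h2.
  by move: h1; rewrite ltnNge h2.
apply: IH => //; first exact: leqW.
move=> j /andP[aj]; rewrite ltnS leq_eqVlt => /predU1P[->//|jk].
by apply: nop; rewrite aj.
Qed.

End marks.

Lemma injective_ord_seq_surj n (y : nat -> 'I_n.+1) :
  (forall i j, (i < n.+1)%N -> (j < n.+1)%N -> y i = y j -> i = j) ->
  forall m, exists2 i, (i < n.+1)%N & m = y i.
Proof.
move=> yinj m; have finj : injective (fun i : 'I_n.+1 => y i).
  by move=> i j /yinj e; apply/val_inj/e.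
by exists (invF finj m); rewrite // (f_invF finj m).
Qed.

(** * Permutations whose cycles are the blocks of a sequence *)
Section block_perm.
Variables (n : nat) (p : nat -> bool).
Hypothesis p0 : p 0%N.
Implicit Types (y : nat -> 'I_n.+1) (s : {perm 'I_n.+1}).

(** The successor of [i], cyclically in its block; it is [feller_next] for the
    Feller marks, and the shift in a record stretch for the record marks. *)
Definition next_in_block (i : nat) : nat :=
  if (i.+1 < n.+1)%N && ~~ p i.+1 then i.+1 else last_mark p i.

(** For an injective [y] with [block_perm y s], this says that [y] is the
    canonical cycle notation of [s]: a term starting a block is below everything
    to its right, so it opens its cycle with the least element, and the cycles
    come in increasing order of their least elements. *)
Definition block_minimal y := forall i j, p i -> (i <= j < n.+1)%N -> (y i <= y j)%N.

Definition block_perm y s := forall i, (i < n.+1)%N -> s (y i) = y (next_in_block i).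

Lemma next_in_block_lt i : (i < n.+1)%N -> (next_in_block i < n.+1)%N.
Proof.
rewrite /next_in_block => iltn; case: ifP => [/andP[]//|_].
exact: leq_ltn_trans (last_mark_le _ _) iltn.
Qed.

Lemma last_mark_next i : last_mark p (next_in_block i) = last_mark p i.
Proof.
rewrite /next_in_block; case: ifP => [/andP[_]|_]; first exact: last_markS.
by rewrite last_mark_id// last_markP.
Qed.

Section cycles.
Variables (y : nat -> 'I_n.+1) (s : {perm 'I_n.+1}).
Hypothesis yinj : forall i j, (i < n.+1)%N -> (j < n.+1)%N -> y i = y j -> i = j.
Hypothesis ymin : block_minimal y.
Hypothesis ys : block_perm y s.

(** The orbit does not leave the block since [next_in_block] preserves
    [last_mark], and it fills it since every term is an image of the start of its
    block. *)
Lemma porbit_block i : (i < n.+1)%N ->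
  porbit s (y i) = [set y j | j : 'I_n.+1 & last_mark p j == last_mark p i]%SET.
Proof.
move=> iltn; apply/setP => m; apply/idP/imsetP.
  move=> /porbitP[k ->]; elim: k => [|k [j]].
    by exists (Ordinal iltn); rewrite ?inE ?expg0 ?perm1.
  rewrite inE => /eqP ji e; rewrite expgSr permM e ys//.
  exists (Ordinal (next_in_block_lt (ltn_ord j))) => //.
  by rewrite inE /= last_mark_next ji.
have start j : (j < n.+1)%N -> porbit s (y j) = porbit s (y (last_mark p j)).
  elim: j => [|j IH] jltn; first by rewrite last_mark_id.
  have [pj|npj] := boolP (p j.+1); first by rewrite last_mark_id.
  rewrite last_markS// -IH; last exact: ltnW.
  have -> : y j.+1 = s (y j) by rewrite ys ?(ltnW jltn)// /next_in_block jltn npj.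
  by rewrite -[s (y j)]/((s ^+ 1)%g (y j)) porbit_perm.
move=> [j]; rewrite inE => /eqP ji ->.
by rewrite -eq_porbit_mem start// ji -start.
Qed.

Lemma card_porbit_block i : (i < n.+1)%N ->
  #|porbit s (y i)| = count (fun j => last_mark p j == last_mark p i) (iota 0 n.+1).
Proof.
move=> iltn; rewrite porbit_block// card_in_imset; last first.
  by move=> j k _ _ /yinj e; apply/val_inj/e.
rewrite -sum1dep_card -(big_mkord (fun j => last_mark p j == last_mark p i) (fun=> 1%N)).
by rewrite /index_iota subn0 sum1_count.
Qed.

Lemma cycle_min_block i : (i < n.+1)%N ->
  [forall m in porbit s (y i), (y i <= m)%N] = p i.
Proof.
move=> iltn; rewrite porbit_block//; apply/forall_inP/idP => [h|pi m].
  have altn : (last_mark p i < n.+1)%N := leq_ltn_trans (last_mark_le _ _) iltn.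
  have : (y i <= y (last_mark p i))%N.
    apply: h; apply/imsetP; exists (Ordinal altn) => //.
    by rewrite inE /= last_mark_id// last_markP.
  have : (y (last_mark p i) <= y i)%N.
    by apply: ymin; [exact: last_markP|rewrite last_mark_le].
  move=> h1 h2; have : y (last_mark p i) = y i by apply/val_inj/eqP; rewrite eqn_leq h1.
  by move=> /(yinj altn iltn) <-; exact: last_markP.
move=> /imsetP[j]; rewrite inE (last_mark_id pi) => /eqP ji ->.
by apply: ymin => //; rewrite ltn_ord andbT -ji last_mark_le.
Qed.

(** Both lists are strictly increasing and have the same elements. *)
Lemma cycle_minima_blocks :
  [seq m <- enum 'I_n.+1 | [forall j in porbit s m, (m <= j)%N]] =
  [seq y a | a <- iota 0 n.+1 & p a].
Proof.
have ltn_ord_trans : transitive (fun i j : 'I_n.+1 => (i < j)%N).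
  by move=> i j k; exact: ltn_trans.
apply: (@irr_sorted_eq _ (fun i j : 'I_n.+1 => (i < j)%N)) => //.
- by move=> i; rewrite /= ltnn.
- apply: sorted_filter => //.
  by rewrite -(@sorted_map _ _ val ltn) val_enum_ord iota_ltn_sorted.
- rewrite sorted_map.
  apply: (@sub_in_sorted _ [pred a | p a && (a < n.+1)%N] ltn).
  + move=> a c /andP[pa an] /andP[pc cn] ac /=.
    rewrite ltn_neqAle ymin// ?cn ?(ltnW ac)// andbT.
    apply/eqP => /val_inj /(yinj an cn) e.
    by rewrite e /= ltnn in ac.
  + by apply/allP => a; rewrite mem_filter mem_iota.
  + by apply: sorted_filter; [exact: ltn_trans|exact: iota_ltn_sorted].
move=> m; have [i iltn ->] := injective_ord_seq_surj yinj m.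
rewrite mem_filter mem_enum andbT cycle_min_block//; apply/idP/mapP => [pi|].
  by exists i; rewrite // mem_filter pi mem_iota.
by move=> [j]; rewrite mem_filter mem_iota /= => /andP[pj jltn] /(yinj iltn jltn) ->.
Qed.

(** The order of the blocks is that of the least elements of the cycles, which
    is the order in which [cycle_lengths] lists the cycles. *)
Theorem cycle_lengths_blocks : p n.+1 ->
  cycle_lengths s = spacings (mkseq p n.+2).
Proof.
move=> pn; rewrite spacings_marks// /cycle_lengths cycle_minima_blocks -map_comp.
apply/eq_in_map => a; rewrite mem_filter mem_iota /= => /andP[pa an].
by rewrite card_porbit_block// last_mark_id.
Qed.

End cycles.

(** The notation is recovered from left to right: inside a block the next term
    is the image under [s], and at a mark it is the least element not yet
    listed. *)
Lemma block_seq_unique y y' s :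
  (forall i j, (i < n.+1)%N -> (j < n.+1)%N -> y i = y j -> i = j) ->
  (forall i j, (i < n.+1)%N -> (j < n.+1)%N -> y' i = y' j -> i = j) ->
  block_minimal y -> block_minimal y' -> block_perm y s -> block_perm y' s ->
  forall i, (i < n.+1)%N -> y i = y' i.
Proof.
have le (z z' : nat -> 'I_n.+1) i : (i < n.+1)%N -> p i ->
    (forall i j, (i < n.+1)%N -> (j < n.+1)%N -> z i = z j -> i = j) ->
    (forall i j, (i < n.+1)%N -> (j < n.+1)%N -> z' i = z' j -> i = j) ->
    block_minimal z -> (forall j, (j < i)%N -> z j = z' j) -> (z i <= z' i)%N.
  move=> iltn pi zinj z'inj zmin zz'; have [j jltn e] := injective_ord_seq_surj zinj (z' i).
  rewrite e; apply: zmin => //; rewrite jltn andbT leqNgt; apply/negP => ji.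
  by move: e; rewrite zz'// => /(z'inj _ _ iltn jltn) ij; rewrite ij ltnn in ji.
move=> yinj y'inj ymin y'min ys y's; elim/ltn_ind => i IH iltn.
have {}IH j : (j < i)%N -> y j = y' j.
  by move=> ji; apply: IH => //; exact: ltn_trans iltn.
have [pi|npi] := boolP (p i).
  apply/val_inj/eqP; rewrite eqn_leq (le y y')//= (le y' y)// => j ji.
  by rewrite IH.
case: i => [|i] in iltn npi IH *; first by rewrite p0 in npi.
have nexti : next_in_block i = i.+1 by rewrite /next_in_block iltn npi.
by rewrite -nexti -ys ?(ltnW iltn)// -y's ?(ltnW iltn)// IH.
Qed.

End block_perm.

(** Partial sums of the spacings give back the marks. *)
Lemma spacings_inj n (p p' : nat -> bool) : p 0%N -> p' 0%N ->
  spacings (mkseq p n.+1) = spacings (mkseq p' n.+1) ->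
  forall i, (i < n.+1)%N -> p i = p' i.
Proof.
have pos (q : nat -> bool) : q 0%N ->
    [seq i <- iota 0 (size (mkseq q n.+1)) | nth false (mkseq q n.+1) i] =
    0%N :: [seq i <- iota 1 n | q i].
  move=> q0; rewrite size_mkseq (eq_in_filter (a2 := q)); last first.
    by move=> i; rewrite mem_iota /= => iltn; rewrite nth_mkseq.
  by rewrite /= q0.
move=> p0 p'0; rewrite /spacings !pos//= => e.
have pathq (q : nat -> bool) : path leq 0%N [seq i <- iota 1 n | q i].
  apply: (@path_filter _ _ leq_trans _ _ (iota 1 n)).
  by rewrite -[path _ _ _]/(sorted leq (iota 0 n.+1)) iota_sorted.
have diff_inj a (l l' : seq nat) : path leq a l -> path leq a l' ->
    pairmap (fun x y => y - x)%N a l = pairmap (fun x y => y - x)%N a l' -> l = l'.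
  elim: l l' a => [|c l IH] [|c' l'] a //= /andP[ac cl] /andP[ac' cl'] [cc' ll'].
  have {}cc' : c = c' by rewrite -(subnKC ac) cc' subnKC.
  by rewrite -cc' in cl' ll' *; rewrite (IH l' c).
have {}e := diff_inj _ _ _ (pathq p) (pathq p') e.
move=> [|i] iltn; first by rewrite p0 p'0.
have : (i.+1 \in [seq i <- iota 1 n | p i]) = (i.+1 \in [seq i <- iota 1 n | p' i]).
  by rewrite e.
by rewrite !mem_filter mem_iota add1n ltnS iltn /= !andbT.
Qed.

(** The Feller procedure reads the indicators backwards; its block starts are the
    ones of the reversed sequence, with a [1] in front. *)
Lemma mkseq_feller n (b : nat -> bool) : b 0%N ->
  true :: rev (mkseq b n.+1) = mkseq (feller_block_start n.+1 b) n.+2.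
Proof.
move=> b0; have sz : size (true :: rev (mkseq b n.+1)) = n.+2.
  by rewrite -[LHS]/(size (rev (mkseq b n.+1))).+1 size_rev size_mkseq.
apply: (@eq_from_nth _ false) => [|i]; rewrite sz ?size_mkseq// => iltn.
rewrite nth_mkseq//; case: i iltn => // i; rewrite ltnS => iltn /=.
by rewrite nth_rev ?size_mkseq// subSS nth_mkseq ?ltnS ?leq_subr// /feller_block_start subSS.
Qed.

Lemma eq_feller_block_start n (b b' : nat -> bool) :
  (forall i, (i < n.+1)%N -> b i = b' i) ->
  feller_block_start n.+1 b = feller_block_start n.+1 b'.
Proof.
move=> bb'; apply/funext => -[|i] //; rewrite /feller_block_start bb'//.
by rewrite subSS ltnS leq_subr.
Qed.

Lemma feller_block_start_inj n (b b' : nat -> bool) : b 0%N -> b' 0%N ->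
  (forall i, (i < n.+2)%N -> feller_block_start n.+1 b i = feller_block_start n.+1 b' i) ->
  forall i, (i < n.+1)%N -> b i = b' i.
Proof.
move=> b0 b'0 e [|i] iltn; first by rewrite b0 b'0.
have := e (n.+1 - i.+1)%N (leq_ltn_trans (leq_subr i.+1 n.+1) (ltnSn _)).
by rewrite /feller_block_start subKn ?(ltnW iltn)// subn_eq0 leqNgt iltn.
Qed.

(** * From record stretches to canonical cycle notation *)
Section record_blocks.
Variables (R : realType) (n : nat) (u : nat -> R).
Hypothesis uinj : forall i j, (i < n.+1)%N -> (j < n.+1)%N -> u i = u j -> i = j.

Let b := is_lower_record u.
Let b0 : b 0%N := is_lower_record0 u.
Let p := feller_block_start n.+1 b.
Let p0 : p 0%N. Proof. by []. Qed.

(** The index of the sequence [u] that stands at position [i] when the stretches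
    are listed from the last one to the first one.  The block of [i] starts at
    [a = last_mark p i]; the [a] positions before it hold the stretches that come
    after index [n - a], so the stretch in question is the one which ends
    at index [n - a], and [i] has offset [i - a] in it. *)
Definition record_to_feller (i : nat) : nat :=
  (last_mark b (n - last_mark p i) + (i - last_mark p i))%N.
Let psi := record_to_feller.

Lemma last_mark_record m : u (last_mark b m) = running_min u m.
Proof.
elim: m => [|m IH]; first by rewrite running_min0 last_mark_id.
rewrite running_minS; have [bm|nbm] := boolP (b m.+1).
  by rewrite last_mark_id// min_r//; move: bm; rewrite /b is_lower_recordS => /ltW.
by rewrite last_markS// IH min_l//; move: nbm; rewrite /b is_lower_recordS -leNgt.
Qed.

Let mark_p k : (0 < k <= n)%N -> b k -> p (n.+1 - k)%N.
Proof.
move=> /andP[k0 kn] bk; rewrite /p /feller_block_start subKn ?bk ?orbT//.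
exact: leqW.
Qed.

Let p_mark a : (0 < a <= n)%N -> p a -> b (n.+1 - a)%N.
Proof. by case: a => // a _; rewrite /p /feller_block_start. Qed.

(** The block of [i] is not longer than its stretch, which would otherwise
    have produced an earlier mark of [p]. *)
Let psi_bound i : (i < n.+1)%N -> (i + last_mark b (n - last_mark p i) <= n)%N.
Proof.
move=> iltn; have := last_mark_le p i; have := last_markP b0 (n - last_mark p i).
have := last_mark_le b (n - last_mark p i).
set a := last_mark p i; set I := last_mark b _ => Ile bI ai.
rewrite leqNgt; apply/negP => nlt.
have pI : p (n.+1 - I)%N by apply: mark_p => //; apply/andP; split; lia.
have := last_mark_max pI (_ : (n.+1 - I <= i)%N); rewrite -/a => h.
have := h ltac:(lia); lia.
Qed.

Let psi_le i : (i < n.+1)%N -> (psi i <= n - last_mark p i)%N.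
Proof.
move=> iltn; have := psi_bound iltn; have := last_mark_le p i.
rewrite /psi /record_to_feller; lia.
Qed.

Lemma record_to_feller_lt i : (i < n.+1)%N -> (psi i < n.+1)%N.
Proof. move=> /psi_le; lia. Qed.

Let last_mark_psi i : (i < n.+1)%N ->
  last_mark b (psi i) = last_mark b (n - last_mark p i).
Proof.
move=> iltn; apply/eqP; rewrite eqn_leq !last_mark_max ?(last_markP b0)//.
  by rewrite /psi /record_to_feller leq_addr.
exact: leq_trans (last_mark_le _ _) (psi_le iltn).
Qed.

Lemma record_to_feller_inj i j : (i < n.+1)%N -> (j < n.+1)%N -> psi i = psi j -> i = j.
Proof.
wlog aij : i j / (last_mark p i <= last_mark p j)%N.
  move=> h iltn jltn e; case: (leqP (last_mark p i) (last_mark p j)) => [|/ltnW] aij.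
    exact: h.
  by apply/esym; apply: h.
move=> iltn jltn e; have := last_mark_psi iltn; rewrite e last_mark_psi// => eI.
have ai := last_mark_le p i; have aj := last_mark_le p j.
have ea : last_mark p i = last_mark p j.
  apply/eqP; rewrite eqn_leq aij /= leqNgt; apply/negP => aij'.
  have bj : b (n.+1 - last_mark p j)%N.
    apply: p_mark; last exact: last_markP.
    by rewrite (leq_ltn_trans _ aij')//= (leq_trans aj).
  have := @last_mark_max b (n - last_mark p i) _ bj; rewrite -eI.
  have := last_mark_le b (n - last_mark p j) => h1 h2.
  by have := h2 ltac:(lia); lia.
move: e; rewrite /psi /record_to_feller ea => /addnI e; lia.
Qed.

(** At a mark [i] the value is the running minimum up to index [n - i], and every
    position after [i] holds an index which is at most [n - i]. *)
Lemma record_to_feller_min i j : p i -> (i <= j < n.+1)%N -> u (psi i) <= u (psi j).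
Proof.
move=> pi /andP[ij jltn].
rewrite {1}/psi /record_to_feller (last_mark_id pi) subnn addn0 last_mark_record.
apply: running_min_le; apply: (leq_trans (psi_le jltn)).
by rewrite leq_sub2l// last_mark_max.
Qed.

(** Reversing the order of the stretches keeps each stretch intact, so it commutes
    with taking the cyclic successor. *)
Lemma record_to_feller_next i : (i < n.+1)%N ->
  next_in_block n b (psi i) = psi (next_in_block n p i).
Proof.
move=> iltn; have ai := last_mark_le p i.
rewrite /(next_in_block n p i).
case: ifP => [/andP[i1 npi]|stop].
  have psiS : psi i.+1 = (psi i).+1.
    by rewrite /psi /record_to_feller last_markS// subSn// addnS.
  have ps := record_to_feller_lt i1; rewrite -/psi psiS in ps.
  rewrite /next_in_block ps /= psiS; case: ifPn => //; rewrite negbK => bpsi.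
  have := last_mark_psi i1; rewrite last_markS// psiS last_mark_id//.
  by rewrite /psi /record_to_feller; lia.
have psia : psi (last_mark p i) = last_mark b (n - last_mark p i).
  by rewrite /psi /record_to_feller [last_mark p (last_mark p i)]last_mark_id ?last_markP// subnn addn0.
have bound := psi_bound iltn.
have psiE : psi i = (n - last_mark p i)%N.
  rewrite /psi /record_to_feller.
  suff : (i + last_mark b (n - last_mark p i) = n)%N by lia.
  apply/eqP; rewrite eqn_leq bound /=.
  move: stop => /negbT; rewrite negb_and negbK ltnS -leqNgt => /orP[ni|pi1]; first by lia.
  have [ni|ilt] := leqP n i; first by lia.
  have bi : b (n.+1 - i.+1)%N by apply: p_mark.
  rewrite subSS in bi.
  by have := last_mark_max bi (leq_sub2l n ai); lia.
rewrite psia -last_mark_psi// /next_in_block; case: ifP => // /andP[lt].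
rewrite psiE; have [a0|a0] := posnP (last_mark p i).
  by move: lt; rewrite psiE a0 subn0 ltnn.
have := p_mark _ (last_markP p0 i); rewrite a0 (leq_trans ai) -1?ltnS// => /(_ isT).
by rewrite subSn ?(leq_trans ai)// => ->.
Qed.

Let uu : uniq (mkseq u n.+1).
Proof. by apply/mkseq_uniqP => i j iltn jltn; exact: uinj. Qed.

Definition rank_ord (k : nat) : 'I_n.+1 := Ordinal (rank_lt u (inord k : 'I_n.+1)).

Lemma rank_ord_inj i j : (i < n.+1)%N -> (j < n.+1)%N -> rank_ord i = rank_ord j -> i = j.
Proof.
move=> iltn jltn /(congr1 val) /= e; apply: uinj => //.
by apply/eqP; rewrite eq_le -[i](inordK iltn) -[j](inordK jltn) -!le_rank e leqnn.
Qed.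

Lemma nth_smallest_rank k : (k < n.+1)%N ->
  nth_smallest u n.+1 (rank_ord k) = u k.
Proof.
move=> kltn; rewrite /nth_smallest; set t := sort _ _.
have ut : uniq t by rewrite sort_uniq.
have st : sorted <%O t by rewrite sort_lt_sorted.
have ukt : u k \in t by rewrite mem_sort; apply/mapP; exists k; rewrite // mem_iota.
suff -> : rank_ord k = index (u k) t :> nat by rewrite nth_index.
rewrite -[RHS](@count_lt_nth _ _ 0 t) ?index_mem// nth_index//.
have -> : count (< u k)%O t = count (< u k)%O (mkseq u n.+1).
  by apply/seq.permP; rewrite perm_sort.
rewrite -[LHS]/(rank u (inord k : 'I_n.+1)) /rank -sum1dep_card count_map.
rewrite -sum1_count -[iota 0 n.+1]/(index_iota 0 n.+1) big_mkord.
by apply: eq_bigl => j; rewrite /= inordK.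
Qed.

(** On ranks, [pi_n] is the cyclic shift inside the record stretches. *)
Lemma perm_pi_rank k : (k < n.+1)%N ->
  perm_pi u n.+1 (rank_ord k) = rank_ord (next_in_block n b k).
Proof.
move=> kltn; apply/val_inj/eqP.
rewrite -(@nth_uniq _ 0 (sort <=%R (mkseq u n.+1))) ?sort_uniq ?size_sort ?size_mkseq ?ltn_ord//.
apply/eqP; rewrite -![nth _ _ _]/(nth_smallest _ _ _) perm_piP// !nth_smallest_rank//; last first.
  exact: next_in_block_lt.
rewrite /perm_piU.
have -> : index (u k) (mkseq u n.+1) = k.
  by rewrite -[u k](nth_mkseq 0 u kltn) index_uniq// size_mkseq.
by rewrite /next_in_block; case: ifP.
Qed.

(** The canonical cycle notation of [pi_n], by the three lemmas that follow. *)
Definition feller_seq (i : nat) : 'I_n.+1 := rank_ord (psi i).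

Lemma feller_seq_inj i j : (i < n.+1)%N -> (j < n.+1)%N ->
  feller_seq i = feller_seq j -> i = j.
Proof.
move=> iltn jltn /rank_ord_inj e; apply: record_to_feller_inj => //.
by apply: e; exact: record_to_feller_lt.
Qed.

Lemma feller_seq_minimal : block_minimal p feller_seq.
Proof.
move=> i j pi /andP[ij jltn]; rewrite /= le_rank.
rewrite !inordK ?record_to_feller_lt ?(leq_ltn_trans ij)//.
by apply: record_to_feller_min; rewrite ?ij.
Qed.

Lemma feller_seq_perm : block_perm p feller_seq (perm_pi u n.+1).
Proof.
move=> i iltn; rewrite /feller_seq perm_pi_rank ?record_to_feller_lt//.
by rewrite record_to_feller_next.
Qed.

Lemma cycle_lengths_perm_pi :
  cycle_lengths (perm_pi u n.+1) = spacings (mkseq p n.+2).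
Proof.
apply: (cycle_lengths_blocks p0 feller_seq_inj feller_seq_minimal feller_seq_perm).
by rewrite /p /feller_block_start subnn b0 orbT.
Qed.

End record_blocks.

(** From [pi_n] one reads off its cycle lengths, hence the records; these
    determine the block starts, and then [pi_n] determines its canonical notation,
    which lists the ranks of all the terms. *)
Lemma perm_pi_inj (R : realType) n (u v : nat -> R) :
  (forall i j, (i < n.+1)%N -> (j < n.+1)%N -> u i = u j -> i = j) ->
  (forall i j, (i < n.+1)%N -> (j < n.+1)%N -> v i = v j -> i = j) ->
  perm_pi u n.+1 = perm_pi v n.+1 -> same_order u v n.+1.
Proof.
move=> uinj vinj uv.
have e := cycle_lengths_perm_pi uinj.
rewrite uv (cycle_lengths_perm_pi vinj) in e.
have bb : forall i, (i < n.+1)%N -> is_lower_record u i = is_lower_record v i.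
  apply: feller_block_start_inj; [exact: is_lower_record0|exact: is_lower_record0|].
  by move=> i iltn; rewrite (spacings_inj isT isT e iltn).
have pp := eq_feller_block_start bb.
have psi_eq i : (i < n.+1)%N -> record_to_feller n u i = record_to_feller n v i.
  move=> iltn; rewrite /record_to_feller pp; congr (_ + _)%N.
  apply: eq_bigl => j; apply: bb; have := ltn_ord j; lia.
have fs := feller_seq_perm uinj; rewrite uv pp in fs.
have fm := @feller_seq_minimal _ n u; rewrite pp in fm.
have y_eq := block_seq_unique (isT : feller_block_start n.+1 (is_lower_record v) 0%N)
  (feller_seq_inj uinj) (feller_seq_inj vinj) fm (@feller_seq_minimal _ n v)
  fs (feller_seq_perm vinj).
have finj : injective (fun i : 'I_n.+1 => Ordinal (record_to_feller_lt u (ltn_ord i))).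
  move=> i j /(congr1 val)/= h; apply/val_inj; exact: record_to_feller_inj h.
have rank_eq k : (k < n.+1)%N -> rank_ord n u k = rank_ord n v k.
  move=> kltn; have := f_invF finj (Ordinal kltn); set i := invF _ _ => /(congr1 val) /= <-.
  by have := y_eq i (ltn_ord i); rewrite /feller_seq psi_eq.
move=> i j iltn jltn; rewrite -[i](inordK iltn) -[j](inordK jltn) -!le_rank.
by have /(congr1 val)/= -> := rank_eq i iltn; have /(congr1 val)/= -> := rank_eq j jltn.
Qed.

(** * Relative ranks *)
Section relative_ranks.
Context (R : realType).
Implicit Types u v : nat -> R.

Definition below u (i : nat) (x : R) : nat := #|[set j : 'I_i | u j < x]%SET|.

(** The rank of a term among its predecessors, counted from [0]. *)
Definition relrank u (i : nat) : nat := below u i (u i).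

Lemma relrank_le u i : (relrank u i <= i)%N.
Proof. by rewrite -[leqRHS]card_ord max_card. Qed.

Lemma relrank_record u i : (forall j, (j < i)%N -> u j <> u i) ->
  (relrank u i == 0%N) = is_lower_record u i.
Proof.
move=> ui; rewrite cards_eq0; apply/eqP/forallP => [h j|h].
  move/setP/(_ j): h; rewrite !inE => /negbT; rewrite -leNgt le_eqVlt.
  by case/predU1P => // e; case: (ui j (ltn_ord j)).
by apply/setP => j; rewrite !inE; apply/negbTE; rewrite -leNgt ltW.
Qed.

(** The rank of the [i]-th term among the first [i] ones locates it with respect
    to each of them. *)
Lemma lt_relrank u i j : (j < i)%N ->
  (u j < u i) = (below u i (u j) < relrank u i)%N.
Proof.
move=> ji; apply/idP/idP => [uji|].
  apply/proper_card/properP; split; last by exists (Ordinal ji); rewrite !inE ?ltxx.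
  by apply/fintype.subsetP => k; rewrite !inE => /lt_trans; exact.
apply: contraTT; rewrite -leNgt -leqNgt => uij; apply/subset_leq_card/fintype.subsetP => k.
by rewrite !inE => /lt_le_trans; exact.
Qed.

Lemma same_order_relrank u v n i : same_order u v n -> (i < n)%N ->
  relrank u i = relrank v i.
Proof.
move=> uv iltn; apply: eq_card => j; rewrite !inE (same_order_lt uv)//.
exact: ltn_trans iltn.
Qed.

(** Inserting the terms one after the other, the relative rank says where the
    next one goes. *)
Lemma relrank_same_order u v n :
  (forall i j, (i < n)%N -> (j < n)%N -> u i = u j -> i = j) ->
  (forall i j, (i < n)%N -> (j < n)%N -> v i = v j -> i = j) ->
  (forall i, (i < n)%N -> relrank u i = relrank v i) -> same_order u v n.
Proof.
elim: n => [//|n IH] uinj vinj uv.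
have {}IH : same_order u v n.
  apply: IH => [i j iltn jltn|i j iltn jltn|i iltn].
  - by apply: uinj; exact: ltnW.
  - by apply: vinj; exact: ltnW.
  - by apply: uv; exact: ltnW.
have lt i : (i < n)%N -> (u i < u n) = (v i < v n).
  move=> iltn; rewrite !lt_relrank// uv//; congr (_ < _)%N.
  by apply: eq_card => j; rewrite !inE (same_order_lt IH).
have cases i : (i < n.+1)%N -> i = n \/ (i < n)%N.
  by rewrite ltnS leq_eqVlt => /predU1P.
move=> i j /cases[->|iltn] /cases[->|jltn].
- by rewrite !lexx.
- by rewrite !leNgt lt.
- rewrite !le_eqVlt lt//; congr (_ || _); apply/eqP/eqP.
    by move=> /(uinj i n (leqW iltn) (ltnSn n)) e; rewrite e ltnn in iltn.
  by move=> /(vinj i n (leqW iltn) (ltnSn n)) e; rewrite e ltnn in iltn.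
- exact: IH.
Qed.

Lemma perm_seq_inj n (q : {perm 'I_n.+1}) i j : (i < n.+1)%N -> (j < n.+1)%N ->
  perm_seq R q i = perm_seq R q j -> i = j.
Proof.
move=> iltn jltn /eqP; rewrite eqr_nat => /eqP/val_inj/perm_inj/(congr1 val) /=.
by rewrite !inordK.
Qed.

Lemma relrank_perm_record n (q : {perm 'I_n.+1}) i : (i < n.+1)%N ->
  (relrank (perm_seq R q) i == 0%N) = is_lower_record (perm_seq R q) i.
Proof.
move=> iltn; apply: relrank_record => j ji /perm_seq_inj e.
by have := e (ltn_trans ji iltn) iltn => e'; rewrite e' ltnn in ji.
Qed.

Variable n : nat.

(** The relative ranks of a pattern, as a finite function; its values are put in
    a common type. *)
Let code (q : {perm 'I_n.+1}) : {ffun 'I_n.+1 -> 'I_n.+1} :=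
  [ffun i : 'I_n.+1 => inord (relrank (perm_seq R q) i)].

Let codeE q (i : 'I_n.+1) : code q i = relrank (perm_seq R q) i :> nat.
Proof.
by rewrite ffunE inordK//; exact: leq_ltn_trans (relrank_le _ _) (ltn_ord i).
Qed.

Let code_inj : injective code.
Proof.
move=> q q' e; apply: (@same_order_perm_inj R); apply: relrank_same_order.
- exact: perm_seq_inj.
- exact: perm_seq_inj.
- by move=> i iltn; have := codeE q (Ordinal iltn); rewrite e codeE.
Qed.

Let codes := [set f : {ffun 'I_n.+1 -> 'I_n.+1} | [forall i : 'I_n.+1, (f i <= i)%N]]%SET.

(** An injection between finite sets of the same cardinality [n.+1`!]. *)
Let code_image : [set code q | q : {perm 'I_n.+1}]%SET = codes.
Proof.
apply/eqP; rewrite eqEcard; apply/andP; split.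
  apply/fintype.subsetP => f /imsetP[q _ ->]; rewrite inE; apply/forallP => i.
  by rewrite codeE relrank_le.
rewrite card_imset// -[X in (_ <= X)%N]/(#|'S_(n.+1)|) card_Sn.
have -> : #|codes| = #|family (fun i : 'I_n.+1 => [pred j : 'I_n.+1 | (j <= i)%N])|.
  by apply: eq_card => f; rewrite inE; apply/forallP/familyP.
rewrite -sum1_card (eq_bigr (fun f : {ffun 'I_n.+1 -> 'I_n.+1} => \prod_(i < n.+1) 1)%N); last first.
  by move=> f _; rewrite big1.
rewrite -(bigA_distr_big_dep _ (fun _ _ => 1%N)) fact_prod big_add1 big_mkord.
apply: leq_prod => i _; rewrite (eq_bigl (fun j : 'I_n.+1 => (j < i.+1)%N))//.
rewrite -(big_ord_widen _ (fun=> 1%N)); last exact: ltn_ord.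
by rewrite sum_nat_const card_ord muln1.
Qed.

(** Relative ranks vary freely, the [i]-th one from [0] to [i], so a sum over
    patterns of a product over ranks factorises.  With weights this computes
    probabilities and normalising constants, and with [wt] constant to [1] it
    counts patterns. *)
Lemma sum_relrank (C : nat -> pred nat) (wt : nat -> R) :
  \sum_(q : {perm 'I_n.+1} | [forall i : 'I_n.+1, C i (relrank (perm_seq R q) i)])
    \prod_(i < n.+1) wt (relrank (perm_seq R q) i) =
  \prod_(i < n.+1) \sum_(k < i.+1 | C i k) wt k.
Proof.
pose Q (i : 'I_n.+1) := [pred j : 'I_n.+1 | C i j && (j < i.+1)%N].
transitivity (\sum_(f in family Q) \prod_(i < n.+1) wt (f i)); last first.
  rewrite -(bigA_distr_big_dep _ (fun _ j => wt (nat_of_ord j))); apply: eq_bigr => i _.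
  by rewrite -(big_ord_widen_cond _ (C i) wt)//; exact: ltn_ord.
pose F (f : {ffun 'I_n.+1 -> 'I_n.+1}) : R :=
  if [forall i : 'I_n.+1, C i (f i)] then \prod_(i < n.+1) wt (f i) else 0.
transitivity (\sum_(f in codes) F f).
  rewrite -code_image big_imset/=; last by move=> ? ? _ _; exact: code_inj.
  rewrite [RHS](eq_bigl xpredT); last by move=> q; rewrite inE.
  rewrite big_mkcond; apply: eq_bigr => q _; rewrite /F.
  under [X in if X then _ else _]eq_forallb do rewrite -codeE.
  by under [X in if _ then X else _]eq_bigr do rewrite -codeE.
rewrite /F -big_mkcondr; apply: eq_bigl => f; rewrite inE.
apply/andP/familyP => [[/forallP h1 /forallP h2] i|h].
  by rewrite inE h2 ltnS h1.
by split; apply/forallP => i; have := h i; rewrite inE ltnS => /andP[].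
Qed.

End relative_ranks.

(** * The bijection between patterns and permutations *)
Section pattern_perm.
Context (R : realType) (n : nat).
Implicit Types (q s : {perm 'I_n.+1}) (b : nat -> bool).

(** The permutation [pi_n] of a sequence with pattern [q]. *)
Definition pattern_perm q : {perm 'I_n.+1} := perm_pi (perm_seq R q) n.+1.

Lemma pattern_perm_inj : injective pattern_perm.
Proof.
move=> q q' /perm_pi_inj h; apply: (@same_order_perm_inj R); apply: h => i j;
  exact: perm_seq_inj.
Qed.

Lemma pattern_perm_surj s : exists q, s = pattern_perm q.
Proof. by exists (invF pattern_perm_inj s); rewrite f_invF. Qed.

Lemma mem_perms_with_spacings b s : b 0%N -> (s \in perms_with_spacings n.+1 b) =
  (cycle_lengths s == spacings (mkseq (feller_block_start n.+1 b) n.+2)).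
Proof. by move=> b0; rewrite inE mkseq_feller. Qed.

Lemma pattern_perm_spacings b q : b 0%N ->
  reflect (forall i, (i < n.+1)%N -> is_lower_record (perm_seq R q) i = b i)
    (pattern_perm q \in perms_with_spacings n.+1 b).
Proof.
move=> b0; rewrite mem_perms_with_spacings// cycle_lengths_perm_pi; last exact: perm_seq_inj.
apply: (iffP eqP) => [e|qb]; last by rewrite (eq_feller_block_start qb).
apply: feller_block_start_inj => //; first exact: is_lower_record0.
exact: spacings_inj e.
Qed.

(** Every cycle has exactly one least element. *)
Lemma card_porbits_cycle_lengths s : #|porbits s| = size (cycle_lengths s).
Proof.
rewrite size_map -(card_uniqP (filter_uniq _ (enum_uniq _))).
pose ismin (m : 'I_n.+1) := [forall j in porbit s m, (m <= j)%N].
have -> : #|[seq m <- enum 'I_n.+1 | ismin m]| = #|[set m | ismin m]%SET|.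
  by apply: eq_card => m; rewrite inE mem_filter mem_enum andbT.
rewrite -(card_in_imset (f := porbit s)).
  apply: eq_card => A; apply/imsetP/imsetP => -[m _ ->].
    pose x := [arg min_(j < m in porbit s m) (j : nat)].
    have xm : x \in porbit s m.
      by rewrite /x; case: arg_minnP => [|//]; exact: porbit_id.
    have porx : porbit s x = porbit s m by apply/eqP; rewrite eq_porbit_mem.
    exists x => //; rewrite inE; apply/forall_inP => j; rewrite porx => jm.
    by rewrite /x; case: arg_minnP => [|k _]; [exact: porbit_id|exact].
  by exists m.
move=> m m'; rewrite !inE => /forall_inP mm /forall_inP m'm e.
apply/val_inj/eqP; rewrite eqn_leq mm ?m'm//; first by rewrite -e porbit_id.
by rewrite e porbit_id.
Qed.

Lemma card_porbits_pattern_perm q :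
  #|porbits (pattern_perm q)| = num_records (perm_seq R q) n.+1.
Proof.
rewrite card_porbits_cycle_lengths cycle_lengths_perm_pi; last exact: perm_seq_inj.
rewrite spacings_marks//; last by rewrite /feller_block_start subnn is_lower_record0 orbT.
rewrite size_map size_filter -sum1_count -[iota 0 n.+1]/(index_iota 0 n.+1) big_mkord.
rewrite big_mkcond /= big_ord_recl /num_records big_ord_recl is_lower_record0.
congr (_ + _)%N; rewrite [RHS](reindex_inj rev_ord_inj) /=; apply: eq_bigr => i _.
rewrite /feller_block_start /bump /= !add1n subSS.
by rewrite subnSK ?ltn_ord//; case: ifP.
Qed.
End pattern_perm.

(** * The Feller coupling *)
Section feller_uniform.
Context (R : realType) (n : nat) (b : nat -> bool).
Hypothesis b0 : b 0%N.
Let p := feller_block_start n.+1 b.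

(** The sequences of positive probability: no repetition, and each term starting a
    block is the least one that is left, that is, the least of the terms from
    there on. *)
Let valid (x : n.+1.-tuple 'I_n.+1) : bool := uniq x &&
  [forall i : 'I_n.+1, forall j : 'I_n.+1, p i && (i <= j)%N ==> (tnth x i <= tnth x j)%N].

(** At position [i] there are [n.+1 - i] elements left to choose from. *)
Let weight (i : nat) : R := if p i then 1 else (n.+1 - i)%:R^-1.

Let nth_inj (x : n.+1.-tuple 'I_n.+1) : uniq x ->
  forall i j, (i < n.+1)%N -> (j < n.+1)%N -> nth ord0 x i = nth ord0 x j -> i = j.
Proof.
move=> ux i j iltn jltn e; apply/eqP.
by rewrite -(nth_uniq ord0 _ _ ux) ?size_tuple// e.
Qed.

Let valid_minimal x : valid x -> block_minimal p (nth ord0 x).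
Proof.
move=> /andP[_ /forallP h] i j pi /andP[ij jltn].
have := forallP (h (Ordinal (leq_ltn_trans ij jltn))) (Ordinal jltn).
by rewrite !(tnth_nth ord0) /= pi ij.
Qed.

Let tuple_surj (x : n.+1.-tuple 'I_n.+1) m : uniq x -> m \in x.
Proof.
move=> ux; have sub : {subset x <= enum 'I_n.+1} by move=> j _; rewrite mem_enum.
have [|_ ->] := uniq_min_size ux sub; last by rewrite mem_enum.
by rewrite size_enum_ord size_tuple.
Qed.

Let mem_take (x : n.+1.-tuple 'I_n.+1) (i j : 'I_n.+1) : uniq x ->
  (tnth x j \in take i x) = (j < i)%N.
Proof.
move=> ux; rewrite (tnth_nth ord0) in_take_leq ?size_tuple ?(ltnW (ltn_ord i))//.
by rewrite index_uniq// size_tuple.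
Qed.

Let feller_step_valid x (i : 'I_n.+1) : valid x ->
  feller_step R b (take i x) (tnth x i) = weight i.
Proof.
move=> vx; have /andP[ux _] := vx; have mx := valid_minimal vx.
have szt : size (take i x) = i by rewrite size_takel// size_tuple ltnW.
rewrite /feller_step szt /weight /p /feller_block_start.
have [i0|i_gt0] := posnP i.
  suff -> : (tnth x i : nat) == 0%N by [].
  rewrite -leqn0; have /tnthP[j e] := tuple_surj ord0 ux.
  rewrite -[leqRHS]/(nat_of_ord (@ord0 n)) e !(tnth_nth ord0).
  by apply: mx; rewrite ?i0 ?ltn_ord.
rewrite /=; case: ifPn => [bi|nbi].
  rewrite mem_take// ltnn (_ : [forall y, _] = true)//.
  apply/forallP => y; apply/implyP; have /tnthP[j ->] := tuple_surj y ux.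
  rewrite mem_take// -leqNgt => ij; rewrite !(tnth_nth ord0).
  by apply: mx; rewrite ?ij ?ltn_ord// /p /feller_block_start bi orbT.
rewrite /uniform_pmf inE mem_take// ltnn mul1r; congr (_%:R^-1).
have ut : uniq (take i x) by rewrite take_uniq.
have := cardC (mem (take i x)); rewrite card_ord (card_uniqP ut) szt => e.
by rewrite -[X in _ = (X - _)%N]e addKn; apply: eq_card => y; rewrite !inE.
Qed.

(** If every factor is nonzero, then no term repeats an earlier one and each block
    start is the least remaining element, so [x] is valid. *)
Let feller_step_invalid x : ~~ valid x -> exists i : 'I_n.+1,
  feller_step R b (take i x) (tnth x i) = 0.
Proof.
move=> nv; have [/existsP[i /eqP]|/existsPn step] :=
  boolP [exists i : 'I_n.+1, feller_step R b (take i x) (tnth x i) == 0]; first by exists i.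
exfalso; move/negP: nv; apply.
have szt (i : 'I_n.+1) : size (take i x) = i.
  by rewrite size_takel// size_tuple ltnW.
have notin (i : 'I_n.+1) : tnth x i \notin take i x.
  have := step i; rewrite /feller_step szt; have [->|_] := posnP i; first by rewrite take0.
  case: ifP => _; first by case: (_ \notin _); rewrite //= eqxx.
  by rewrite /uniform_pmf inE; case: (_ \notin _); rewrite //= mul0r eqxx.
have ux : uniq x.
  apply/(uniqP ord0) => i j; rewrite !inE size_tuple.
  wlog ij : i j / (i <= j)%N.
    move=> h iltn jltn e; case: (leqP i j) => [|/ltnW] ij; first exact: h.
    by apply/esym; apply: h.
  move=> iltn jltn e; apply/eqP; rewrite eqn_leq ij /= leqNgt; apply/negP => ij'.
  have := notin (Ordinal jltn); rewrite (tnth_nth ord0) /= -e => /negP; apply.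
  by rewrite -(nth_take ord0 ij') mem_nth// size_takel ?size_tuple// ltnW.
rewrite /valid ux /=; apply/forallP => i; apply/forallP => j; apply/implyP => /andP[pi ij].
have := step i; rewrite /feller_step szt.
have [i0|i_gt0] := posnP i.
  by case: (tnth x i =P 0%N :> nat) => [->|_]; rewrite ?eqxx.
move: pi; rewrite /p /feller_block_start gtn_eqF//= => ->.
case: forallP; rewrite ?andbF ?eqxx// => h _.
by have := h (tnth x j); rewrite mem_take// -leqNgt ij.
Qed.

Let feller_seq_pmfE x : feller_seq_pmf R b x =
  if valid x then \prod_(i < n.+1) weight i else 0.
Proof.
rewrite /feller_seq_pmf; case: ifPn => [vx|/feller_step_invalid[i fi]].
  by apply: eq_bigr => i _; rewrite feller_step_valid.
by rewrite (bigD1 i)//= fi mul0r.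
Qed.

(** Permutations with these spacings correspond to patterns with records [b].  A
    record leaves one relative rank, a non-record [i] leaves [i] of them.  The
    factor [i] cancels the weight of position [n.+1 - i]. *)
Let card_spacings :
  #|perms_with_spacings n.+1 b|%:R * \prod_(i < n.+1) weight i = 1.
Proof.
rewrite -sum1_card natr_sum (reindex_inj (@pattern_perm_inj R n)).
pose C i := [pred k : nat | (k == 0%N) == b i].
rewrite (eq_bigl (fun q => [forall i : 'I_n.+1, C i (relrank (perm_seq R q) i)])); last first.
  move=> q; apply/(pattern_perm_spacings R q b0)/forallP => h i.
    by rewrite inE relrank_perm_record ?h.
  by move=> iltn; have := h (Ordinal iltn); rewrite inE relrank_perm_record// => /eqP.
under eq_bigr.
  move=> q _; rewrite (_ : 1%:R = \prod_(i < n.+1) (fun=> 1) (relrank (perm_seq R q) i)); last first.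
    by rewrite big1.
  over.
rewrite (sum_relrank n C (fun=> 1)).
rewrite (eq_bigr (fun i : 'I_n.+1 => if b i then 1 else i%:R : R)); last first.
  move=> i _; rewrite big_mkcond big_ord_recl /=.
  rewrite (eq_bigr (fun=> if b i then 0 else 1)); last first.
    by move=> k _; rewrite /bump /=; case: (b i).
  rewrite big_const card_ord iter_addr_0; case: (b i); first by rewrite mul0rn addr0.
  by rewrite add0r.
rewrite !big_ord_recl b0 mul1r /weight /p {1}/feller_block_start eqxx mul1r.
rewrite (reindex_inj rev_ord_inj) -big_split big1// => i _ /=.
rewrite /feller_block_start /bump /= !add1n subSS subnSK//.
case: ifP => _; first by rewrite mulr1.
by rewrite divff// pnatr_eq0 subn_eq0 -ltnNge ltn_ord.
Qed.

Lemma is_feller_permP (x : n.+1.-tuple 'I_n.+1) (s : {perm 'I_n.+1}) :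
  is_feller_perm b x s -> block_perm p (nth ord0 x) s.
Proof.
move=> /forallP h i iltn; have /eqP := h (Ordinal iltn).
rewrite !(tnth_nth ord0) /= => ->; apply: set_nth_default.
by rewrite size_tuple next_in_block_lt.
Qed.

(** All the valid sequences have the same probability, and exactly one of them
    yields [s] when [s] has the right spacings: its canonical cycle notation.
    Existence comes from [feller_seq] applied to the pattern of [s], uniqueness
    from [block_seq_unique]. *)
Lemma feller_pmf_uniform s :
  feller_pmf R b s = uniform_pmf R (perms_with_spacings n.+1 b) s.
Proof.
rewrite /feller_pmf /uniform_pmf.
have p0 : p 0%N by [].
have pn : p n.+1 by rewrite /p /feller_block_start subnn b0 orbT.
have [c0|c0] := eqVneq (#|perms_with_spacings n.+1 b|%:R : R) 0.
  by move: card_spacings => /eqP; rewrite c0 mul0r eq_sym oner_eq0.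
have -> : #|perms_with_spacings n.+1 b|%:R^-1 = \prod_(i < n.+1) weight i.
  by rewrite -[RHS](mulKf c0) card_spacings mulr1.
under eq_bigr do rewrite feller_seq_pmfE.
rewrite -big_mkcondr /=.
have [sin|snotin] := boolP (s \in _); last first.
  rewrite mul0r big1// => x /andP[/is_feller_permP xs vx].
  have /andP[ux _] := vx; move: snotin; rewrite mem_perms_with_spacings//.
  by rewrite (cycle_lengths_blocks p0 (nth_inj ux) (valid_minimal vx) xs)// eqxx.
have [q sq] := pattern_perm_surj R s.
have qb : forall i, (i < n.+1)%N -> is_lower_record (perm_seq R q) i = b i.
  by apply/(pattern_perm_spacings R q b0); rewrite -sq.
have qinj := @perm_seq_inj R n q.
have pq := eq_feller_block_start qb.
pose x := [tuple feller_seq n (perm_seq R q) i | i < n.+1].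
have nthx i : (i < n.+1)%N -> nth ord0 x i = feller_seq n (perm_seq R q) i.
  by move=> iltn; rewrite -[i]/(val (Ordinal iltn)) -tnth_nth tnth_mktuple.
have fmin := @feller_seq_minimal R n (perm_seq R q); rewrite pq in fmin.
have fperm := feller_seq_perm qinj; rewrite pq in fperm.
have ux : uniq x.
  apply/(uniqP ord0) => i j; rewrite !inE size_tuple => iltn jltn.
  by rewrite !nthx//; exact: (feller_seq_inj qinj).
have vx : valid x.
  rewrite /valid ux; apply/forallP => i; apply/forallP => j; apply/implyP => /andP[pi ij].
  by rewrite !tnth_mktuple; apply: fmin; rewrite ?ij ?ltn_ord.
have xs : is_feller_perm b x s.
  apply/forallP => i; rewrite tnth_mktuple sq /pattern_perm fperm// eq_sym; apply/eqP.
  rewrite -[feller_next _ _ _]/(next_in_block n p i).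
  by rewrite (set_nth_default ord0) ?size_tuple ?next_in_block_lt// nthx// next_in_block_lt.
rewrite mul1r (big_pred1 x)// => y; apply/andP/eqP => [[ys vy]|-> //].
have /andP[uy _] := vy; apply: eq_from_tnth => i.
rewrite !(tnth_nth ord0).
exact: (block_seq_unique p0 (nth_inj uy) (nth_inj ux) (valid_minimal vy)
  (valid_minimal vx) (is_feller_permP ys) (is_feller_permP xs)).
Qed.
End feller_uniform.

(** * Joint law of the record indicators *)
Section relrank_law.
Context (R : realType) d (T : measurableType d) (P : probability T R).
Context (theta : R) (U : nat -> {RV P >-> R}).
Hypothesis theta_gt0 : 0 < theta.
Hypothesis lawU : has_law_Ptheta theta U.

(** A record, that is, relative rank [0], has weight [theta]. *)
Definition rank_weight (k : nat) : R := if k == 0%N then theta else 1.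

Lemma theta_num_records n (q : {perm 'I_n.+1}) :
  theta ^+ num_records (perm_seq R q) n.+1 =
  \prod_(i < n.+1) rank_weight (relrank (perm_seq R q) i).
Proof.
rewrite /num_records expr_sum; apply: eq_bigr => i _.
by rewrite /rank_weight relrank_perm_record//; case: is_lower_record.
Qed.

Lemma sum_rank_weight i : \sum_(k < i.+1) rank_weight k = theta + i%:R.
Proof.
rewrite big_ord_recl /rank_weight /=; congr (_ + _).
by rewrite big_const card_ord iter_addr_0.
Qed.

Lemma sum_theta_num_records n :
  \sum_(q : {perm 'I_n.+1}) theta ^+ num_records (perm_seq R q) n.+1 =
  \prod_(i < n.+1) (theta + i%:R).
Proof.
under [RHS]eq_bigr do rewrite -sum_rank_weight.
rewrite -(sum_relrank n (fun _ _ => true)); apply: eq_big => [q|q _].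
  by apply/esym/forallP.
exact: theta_num_records.
Qed.

(** The pattern events have total probability [1], which excludes ties, so [E] is
    known up to a null set from the patterns it contains. *)
Lemma order_event_law n (E : set T) (F : pred {perm 'I_n.+1}) : measurable E ->
  (forall q w, pattern_event U q w -> E w <-> F q) ->
  P E = (\sum_(q | F q) theta ^+ num_records (perm_seq R q) n.+1 /
    \prod_(i < n.+1) (theta + i%:R))%:E.
Proof.
move=> mE EF; pose V := \bigcup_q pattern_event (n := n) U q.
have mpat q := measurable_pattern_event U (n := n) q.
have Z_gt0 : 0 < \prod_(i < n.+1) (theta + i%:R).
  by apply: prodr_gt0 => i _; apply: ltr_pwDl.
have PV : P V = 1%E.
  rewrite /V measure_bigcup_finType//; last exact: trivIset_pattern_event.
  rewrite (eq_bigr _ (fun q _ => pattern_law theta_gt0 lawU q)) sumEFin.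
  by rewrite -mulr_suml sum_theta_num_records divff// gt_eqF.
have mV : measurable V by rewrite /V bigcup_finType; exact: bigsetU_measurable.
have PEV : P (E `\` V) = 0%E.
  apply/eqP; rewrite eq_le measure_ge0 andbT.
  apply: (@le_trans _ _ (P (~` V))); last by rewrite probability_setC// PV subee.
  apply: le_measure; rewrite ?inE//; first exact: measurableD.
  exact: measurableC.
have -> : P E = P (E `&` V).
  by rewrite [LHS](measureDI P mE mV) [X in (X + _)%E]PEV add0e.
rewrite /V setI_bigcupr measure_bigcup_finType//; last 2 first.
- by move=> q; exact: measurableI.
- by apply: trivIset_setIl; exact: trivIset_pattern_event.
rewrite -sumEFin [RHS]big_mkcond /=; apply: eq_bigr => q _.
case: ifPn => Fq.
  rewrite -sum_theta_num_records -(pattern_law theta_gt0 lawU) setIidr//.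
  by move=> w /EF ->.
rewrite [X in P X](_ : _ = set0) ?measure0//.
by apply/seteqP; split => // w [Ew /EF wq]; move/negP: Fq; apply; exact/wq.
Qed.

Definition rank_prob (i : nat) (C : pred nat) : R :=
  (\sum_(k < i.+1 | C k) rank_weight k) / (theta + i%:R).

(** Independence of the relative ranks: the [i]-th one has probabilities
    proportional to [rank_weight] on [0], ..., [i]. *)
Lemma relrank_law n (E : set T) (C : nat -> pred nat) : measurable E ->
  (forall q w, pattern_event (n := n) U q w ->
    E w <-> [forall i : 'I_n.+1, C i (relrank (perm_seq R q) i)]) ->
  P E = (\prod_(i < n.+1) rank_prob i (C i))%:E.
Proof.
move=> mE EC; rewrite (order_event_law mE EC) -mulr_suml.
under eq_bigr do rewrite theta_num_records.
by rewrite sum_relrank -prodf_div.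
Qed.

Lemma record_indicator_relrank n (q : {perm 'I_n.+1}) w i : pattern_event U q w ->
  (i < n.+1)%N -> record_indicator U i w = (relrank (perm_seq R q) i == 0%N).
Proof.
by move=> wq iltn; rewrite /record_indicator (same_order_record wq)// relrank_perm_record.
Qed.

Let B : nat -> {RV P >-> bool} := fun i => record_indicator U i.

Let measurable_B i (A : set bool) : measurable (B i @^-1` A).
Proof. exact: measurable_funPTI. Qed.

(** An indicator is a function of its relative rank.  The indices up to the
    maximum of [J] which are not in [J] are unconstrained and contribute [1]. *)
Lemma records_joint_law (J : {fset nat}) (A : nat -> set bool) :
  P (\bigcap_(i in [set` J]) (B i @^-1` A i)) =
  (\prod_(i <- J) rank_prob i (fun k => (k == 0%N) \in A i))%:E.
Proof.
pose n := \max_(i <- J) i.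
have Jn i : i \in J -> (i < n.+1)%N.
  by move=> iJ; rewrite ltnS; exact: (@leq_bigmax_seq _ _ xpredT id i iJ isT).
rewrite (@relrank_law n _ (fun i k => (i \in J) ==> ((k == 0%N) \in A i))); first last.
- move=> q w wq; split => [h|/forallP h i /= iJ].
    apply/forallP => i; apply/implyP => iJ; rewrite inE.
    by rewrite -(record_indicator_relrank wq)//; exact: h.
  have := h (Ordinal (Jn i iJ)); rewrite /= iJ /= inE.
  by rewrite -(record_indicator_relrank wq)//; exact: Jn.
- by apply: fin_bigcap_measurable => // i _; exact: measurable_B.
congr EFin; rewrite -(big_mkord xpredT (fun i => rank_prob i
  (fun k => (i \in J) ==> ((k == 0%N) \in A i)))).
rewrite (bigID [in J]) /= [X in _ * X]big1 ?mulr1; last first.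
  move=> i /negbTE iJ; rewrite /rank_prob iJ /= sum_rank_weight divff//.
  by rewrite gt_eqF// ltr_pwDl.
rewrite -big_filter; rewrite (perm_big J); last first.
  apply: uniq_perm; rewrite ?filter_uniq ?iota_uniq ?fset_uniq// => i.
  rewrite mem_filter mem_index_iota /=; apply/andP/idP => [[]//|iJ].
  by split => //; exact: Jn.
rewrite big_seq [RHS]big_seq; apply: eq_bigr => i iJ.
by rewrite iJ.
Qed.

Lemma record_law i (A : set bool) :
  P (B i @^-1` A) = (rank_prob i (fun k => (k == 0%N) \in A))%:E.
Proof.
have := records_joint_law [fset i]%fset (fun=> A).
by rewrite set_fset1 bigcap_set1 big_seq_fset1.
Qed.

Lemma records_independent : mutually_independent B.
Proof.
move=> J A _; rewrite records_joint_law -prodEFin; apply: eq_bigr => i _.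
by rewrite record_law.
Qed.

Lemma record_bernoulli i :
  distribution P (B i) =1 bernoulli_prob (theta / (i%:R + theta)).
Proof.
apply: eq_bernoulli; rewrite [LHS]record_law /rank_prob (big_pred1 ord0).
  by rewrite /rank_weight eqxx addrC.
by move=> k; apply/idP/idP; rewrite inE.
Qed.
End relrank_law.

(** * Conditional law given the records, and the Ewens law *)
Section conditional_laws.
Context (R : realType) d (T : measurableType d) (P : probability T R).
Context (theta : R) (U : nat -> {RV P >-> R}).
Hypothesis theta_gt0 : 0 < theta.
Hypothesis lawU : has_law_Ptheta theta U.

Let B : nat -> {RV P >-> bool} := fun i => record_indicator U i.

Let measurable_B i (A : set bool) : measurable (B i @^-1` A).
Proof. exact: measurable_funPTI. Qed.

Let Pi n : {RV P >-> {perm 'I_n}} := perm_pi_rv U n.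

Let measurable_Pi n (A : set {perm 'I_n}) : measurable (Pi n @^-1` A).
Proof. exact: measurable_funPTI. Qed.

Lemma perm_pi_pattern n m (q : {perm 'I_m.+1}) w : (n <= m.+1)%N ->
  pattern_event U q w -> Pi n w = perm_pi (perm_seq R q) n.
Proof.
move=> nm wq; apply: eq_perm_pi => i j iltn jltn.
by apply: wq; exact: leq_trans nm.
Qed.

(** The bijection [pattern_perm] turns the number of records into the number of
    cycles. *)
Theorem ewens_law n :
  distribution P (Pi n.+1) =1 finite_law (ewens_pmf theta (n := n.+1)).
Proof.
move=> A; rewrite [LHS](@order_event_law _ _ _ _ _ _ theta_gt0 lawU n _
  (fun q => pattern_perm R q \in A)).
- congr EFin; rewrite [RHS](reindex_inj (@pattern_perm_inj R n)).
  by apply: eq_bigr => q _; rewrite /ewens_pmf card_porbits_pattern_perm.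
- exact: measurable_Pi.
- move=> q w wq; rewrite inE /preimage /=.
  by rewrite (perm_pi_pattern (leqnn _) wq).
Qed.

Definition record_cylinder (m : nat) (b : nat -> bool) : set T :=
  \bigcap_(i in `I_m.+1) (B i @^-1` [set b i]).

Lemma measurable_record_cylinder m b : measurable (record_cylinder m b).
Proof. by apply: fin_bigcap_measurable => // i _; exact: measurable_B. Qed.

Lemma record_cylinder_pattern m b (q : {perm 'I_m.+1}) w : pattern_event U q w ->
  record_cylinder m b w <->
  forall i, (i < m.+1)%N -> (relrank (perm_seq R q) i == 0%N) = b i.
Proof.
move=> wq; split => h i iltn.
  by rewrite -(record_indicator_relrank wq)//; exact: h.
by rewrite /= [LHS](record_indicator_relrank wq)//; exact: h.
Qed.

Section cylinder.
Variables (n m : nat) (b : nat -> bool).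
Hypotheses (b0 : b 0%N) (nm : (n <= m)%N).

Let pws := perms_with_spacings n.+1 b.

(** The probability that the [i]-th relative rank is the one which [s] prescribes,
    for [i <= n], and that it agrees with [b] for the larger [i].  A rank that is
    prescribed has weight [theta] or [1] according to [b], so [c] does not depend
    on [s]. *)
Let c : R := \prod_(i < m.+1)
  if (i < n.+1)%N then (if b i then theta else 1) / (theta + i%:R)
  else rank_prob theta i (fun k => (k == 0%N) == b i).

(** Fixing [pi_n] is fixing the first relative ranks.  These then give
    the first indicators, while the later indicators constrain the other relative
    ranks only. *)
Let cylinder_perm_law s :
  P (record_cylinder m b `&` Pi n.+1 @^-1` [set s]) = (c * (s \in pws)%:R)%:E.
Proof.
have mE : measurable (record_cylinder m b `&` Pi n.+1 @^-1` [set s]).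
  by apply: measurableI; [exact: measurable_record_cylinder|exact: measurable_Pi].
have inj0 (q : {perm 'I_m.+1}) i j : (i < n.+1)%N -> (j < n.+1)%N ->
    perm_seq R q i = perm_seq R q j -> i = j.
  by move=> iltn jltn; apply: perm_seq_inj; exact: leq_trans nm.
have [sin|snotin] := boolP (s \in pws); last first.
  rewrite mulr0 (@order_event_law _ _ _ _ _ _ theta_gt0 lawU m _ pred0) ?big_pred0//.
  move=> q w wq; split => // -[/(record_cylinder_pattern _ wq) qb].
  rewrite /preimage /= (perm_pi_pattern _ wq)// => qs.
  move: snotin; rewrite /pws -qs mem_perms_with_spacings//.
  rewrite cycle_lengths_perm_pi; last exact: inj0.
  rewrite (eq_feller_block_start (b' := b)) ?eqxx// => i iltn.
  by rewrite -qb ?(leq_trans iltn)// relrank_perm_record// (leq_trans iltn).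
have [q0 sq0] := pattern_perm_surj R s.
have q0b : forall i, (i < n.+1)%N -> is_lower_record (perm_seq R q0) i = b i.
  by apply/(pattern_perm_spacings R q0 b0); rewrite -sq0.
have q0inj := @perm_seq_inj R n q0.
have rank0 i : (i < n.+1)%N -> (relrank (perm_seq R q0) i == 0%N) = b i.
  by move=> iltn; rewrite relrank_perm_record// q0b.
rewrite mulr1 (@relrank_law _ _ _ _ _ _ theta_gt0 lawU m _
  (fun i k => if (i < n.+1)%N then k == relrank (perm_seq R q0) i else (k == 0%N) == b i))//.
  congr EFin; apply: eq_bigr => i _; case: ifPn => iltn; last by rewrite /rank_prob.
  rewrite /rank_prob; congr (_ / _).
  have ri : (relrank (perm_seq R q0) i < i.+1)%N by rewrite ltnS relrank_le.
  by rewrite (big_pred1 (Ordinal ri))// /rank_weight /= -(rank0 _ iltn).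
move=> q w wq; split => [[/(record_cylinder_pattern _ wq) qb]|/forallP h].
  rewrite /preimage /= (perm_pi_pattern _ wq)// sq0 => /(perm_pi_inj (inj0 q) q0inj) qq0.
  apply/forallP => i; case: ifPn => iltn; last by rewrite qb.
  by rewrite (same_order_relrank qq0).
have {}h i : (i < m.+1)%N -> if (i < n.+1)%N
    then relrank (perm_seq R q) i == relrank (perm_seq R q0) i
    else (relrank (perm_seq R q) i == 0%N) == b i.
  by move=> iltm; exact: (h (Ordinal iltm)).
split.
  apply/(record_cylinder_pattern _ wq) => i iltm; have := h i iltm.
  by case: ifPn => iltn /eqP ->//; rewrite rank0.
rewrite /preimage /= (perm_pi_pattern _ wq)// sq0; apply: eq_perm_pi.
apply: relrank_same_order => [||i iltn]; [exact: inj0|exact: q0inj|].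
by have := h i (leq_trans iltn (nm : (n.+1 <= m.+1)%N)); rewrite iltn => /eqP.
Qed.

(** Given the cylinder all the permutations with spacings [b] are equally likely,
    by the preceding lemma; the constant [c] drops out. *)
Lemma cylinder_conditional_law (A : set {perm 'I_n.+1}) :
  P (record_cylinder m b `&` Pi n.+1 @^-1` A) =
  (finite_law (uniform_pmf R pws) A * P (record_cylinder m b))%E.
Proof.
have additive (A' : set {perm 'I_n.+1}) :
    P (record_cylinder m b `&` Pi n.+1 @^-1` A') = (\sum_(s | s \in A') c * (s \in pws)%:R)%:E.
  pose F s := if s \in A' then record_cylinder m b `&` Pi n.+1 @^-1` [set s] else set0.
  have -> : record_cylinder m b `&` Pi n.+1 @^-1` A' = \bigcup_s F s.
    apply/seteqP; split => w.
      by move=> [cw Aw]; exists (Pi n.+1 w) => //; rewrite /F mem_set.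
    by move=> [s _]; rewrite /F; case: ifPn => // /set_mem As [cw /= ->].
  rewrite measure_bigcup_finType; first last.
  - move=> s s' _ _ [w []]; rewrite /F; case: ifP => // _ [_ /= <-].
    by case: ifP => // _ [_ /= <-].
  - move=> s; rewrite /F; case: ifP => // _.
    by apply: measurableI; [exact: measurable_record_cylinder|exact: measurable_Pi].
  rewrite -sumEFin [RHS]big_mkcond; apply: eq_bigr => s _; rewrite /F.
  by case: ifP => _; [exact: cylinder_perm_law|rewrite measure0].
have -> : P (record_cylinder m b) = (c * #|pws|%:R)%:E.
  rewrite -[in LHS](setIT (record_cylinder m b)) -(preimage_setT (Pi n.+1)) additive.
  rewrite (eq_bigl xpredT); last by move=> s; rewrite in_setT.
  rewrite -mulr_sumr -sum1_card natr_sum [X in _ = (_ * X)%:E]big_mkcond.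
  by congr (_ * _)%:E; apply: eq_bigr => s _; case: ifP.
rewrite additive /finite_law -EFinM; congr EFin.
have [pws0|pws0] := eqVneq (#|pws|%:R : R) 0.
  rewrite pws0 !mulr0 big1// => s _.
  by move/eqP: pws0; rewrite pnatr_eq0 cards_eq0 => /eqP ->; rewrite inE mulr0.
under [X in _ = X * _]eq_bigr do rewrite /uniform_pmf -/pws mulrC.
by rewrite -!mulr_sumr [c * #|_|%:R]mulrC mulrAC mulrA (mulVf pws0) mul1r.
Qed.

End cylinder.

Lemma eq_perms_with_spacings n (b b' : nat -> bool) :
  (forall i, (i < n)%N -> b i = b' i) ->
  perms_with_spacings n b = perms_with_spacings n b'.
Proof.
move=> bb'; rewrite /perms_with_spacings (_ : mkseq b n = mkseq b' n)//.
by apply/eq_in_map => i; rewrite mem_iota => /andP[_]; exact: bb'.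
Qed.

Lemma measurable_of_records (D : set nat) n (h : {ffun 'I_n.+1 -> bool} -> \bar R) :
  `I_n.+1 `<=` D ->
  measurable_fun [set: g_sigma_algebraType (sigma_of D (fun i => B i : T -> bool))]
    (fun w : T => h [ffun i : 'I_n.+1 => B i w]).
Proof.
move=> nD; pose G := g_sigma_algebraType (sigma_of D (fun i => B i : T -> bool)).
move=> _ Y _; rewrite setTI.
have -> : (fun w : T => h [ffun i : 'I_n.+1 => B i w]) @^-1` Y =
    \bigcup_(f in [set f | Y (h f)]) \bigcap_(i in [set: 'I_n.+1]) (B i @^-1` [set f i]).
  apply/seteqP; split => w.
    by move=> Yw; exists [ffun i : 'I_n.+1 => B i w] => // i _; rewrite /= ffunE.
  move=> [f Yf fw]; rewrite /preimage /= (_ : [ffun _ => _] = f)//.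
  by apply/ffunP => i; rewrite ffunE; exact: (fw i I).
apply: (@fin_bigcup_measurable _ G) => [|f _]; first exact: finite_finset.
apply: (@fin_bigcap_measurable _ G) => [|i _]; first exact: finite_finset.
by apply: sub_sigma_algebra; apply: sigma_of_preimage => //; exact/nD/ltn_ord.
Qed.

(** The conditional law.  By [feller_pmf_uniform] it is that of the Feller
    coupling as well. *)
Let kernel n (A : set {perm 'I_n.+1}) (w : T) : \bar R :=
  finite_law (uniform_pmf R (perms_with_spacings n.+1 (fun i => B i w))) A.

Lemma measurable_kernel (D : set nat) n A : `I_n.+1 `<=` D ->
  measurable_fun [set: g_sigma_algebraType (sigma_of D (fun i => B i : T -> bool))]
    (kernel (n := n) A : T -> \bar R).
Proof.
move=> nD; pose h (f : {ffun 'I_n.+1 -> bool}) := finite_law (uniform_pmf R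
  (perms_with_spacings n.+1 (fun i => f (inord i)))) A.
rewrite (_ : kernel A = fun w => h [ffun i : 'I_n.+1 => B i w]).
  exact: measurable_of_records.
apply/funext => w; rewrite /kernel /h; congr (finite_law (uniform_pmf R _) A).
by apply: eq_perms_with_spacings => i iltn; rewrite ffunE inordK.
Qed.

Lemma sigma_records_measurable (D : set nat) E :
  <<s sigma_of D (fun i => B i : T -> bool)>> E -> measurable E.
Proof.
apply: smallest_sub; first exact: sigma_algebra_measurable.
by move=> F; apply: sigma_of_measurable => i _.
Qed.

(** A pi-system generating the sigma-algebra of all the indicators.  Only cylinders
    that fix at least the first [n.+1] indicators are taken, so that [kernel] is
    constant on each of them. *)
Let cylinders n : set_system T :=
  [set C | C = set0 \/ exists m b, (n <= m)%N /\ C = record_cylinder m b].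

Let cylinders_setI n : setI_closed (cylinders n).
Proof.
have wlog_case m b m' b' : (n <= m)%N -> (m <= m')%N ->
    cylinders n (record_cylinder m b `&` record_cylinder m' b').
  move=> nm mm'; have [agree|] := pselect (forall i, (i < m.+1)%N -> b i = b' i).
    right; exists m', b'; split; first exact: leq_trans mm'.
    apply/setIidPr => w w' i iltm; rewrite /= agree//; apply: w'.
    exact: leq_trans mm'.
  move=> /existsNP[i /not_implyP[iltm bb']]; left; apply/seteqP; split => // w [wb wb'].
  by apply: bb'; rewrite -(wb i iltm) (wb' i (leq_trans iltm (mm' : (m.+1 <= m'.+1)%N))).
move=> C C' [->|[m [b [nm ->]]]]; first by rewrite set0I; left.
move=> [->|[m' [b' [nm' ->]]]]; first by rewrite setI0; left.
by have [mm'|/ltnW mm'] := leqP m m'; [exact: wlog_case|rewrite setIC; exact: wlog_case].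
Qed.

Let sigma_of_cylinders n : <<s sigma_of [set: nat] (fun i => B i : T -> bool)>> `<=`
  <<s cylinders n>>.
Proof.
apply: smallest_sub; first exact: smallest_sigma_algebra.
apply: smallest_sub; first exact: smallest_sigma_algebra.
move=> _ [i _ [A _ <-]]; rewrite setTI; pose m := maxn n i.
have im : (i < m.+1)%N by rewrite ltnS leq_maxr.
have -> : (B i : T -> bool) @^-1` A = \bigcup_(f in [set f : {ffun 'I_m.+1 -> bool} | A (f (inord i))])
    record_cylinder m (fun j => f (inord j)).
  apply/seteqP; split => w.
    move=> Aw; exists [ffun j : 'I_m.+1 => B j w] => [|j jltm]; by rewrite /= ffunE inordK.
  by move=> [f Af fw]; rewrite /preimage /= (fw i im).
apply: (@fin_bigcup_measurable _ (g_sigma_algebraType (cylinders n))) => [|f _].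
  exact: finite_finset.
apply: sub_sigma_algebra; right; exists m, (fun j => f (inord j)); split => //.
exact: leq_maxl.
Qed.

(** Both sides are finite measures in [E], and they agree on the cylinders. *)
Theorem records_conditional_law n (A : set {perm 'I_n.+1}) E :
  <<s sigma_of [set: nat] (fun i => B i : T -> bool)>> E ->
  P (E `&` Pi n.+1 @^-1` A) = (\int[P]_(w in E) kernel A w)%E.
Proof.
have mK : measurable_fun [set: T] (kernel A : T -> \bar R).
  move=> _ Y mY; rewrite setTI.
  have := @measurable_kernel [set: nat] n A (@subsetT _ _) measurableT Y mY.
  by rewrite setTI; exact: sigma_records_measurable.
have K0 w : (0 <= kernel A w)%E.
  by rewrite lee_fin; apply: sumr_ge0 => s _; rewrite divr_ge0.
move=> /(@sigma_of_cylinders n) sE.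
(* The finitely many shortest cylinders cover the space. *)
pose f k : set T := nth set0 [seq record_cylinder n (fun i => (g : {ffun 'I_n.+1 -> bool}) (inord i)) |
  g <- enum {ffun 'I_n.+1 -> bool}] k.
have fcyl k : cylinders n (f k).
  rewrite /f; set s := map _ _; have [ks|ks] := ltnP k (size s).
    have /mapP[g _ ->] := mem_nth set0 ks; right; exists n; eexists; split; last reflexivity.
    exact: leqnn.
  by rewrite nth_default//; left.
apply: (@g_sigma_algebra_measure_unique _ _ _ (cylinders n) _ f fcyl _
  (mrestr P (measurable_Pi A)) (density_measure P mK K0)) => //.
- by move=> C [->//|[m [b [_ ->]]]]; exact: measurable_record_cylinder.
- rewrite -subTset => w _; pose g := [ffun i : 'I_n.+1 => B i w].
  exists (index g (enum {ffun 'I_n.+1 -> bool})) => //.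
  rewrite /f (nth_map g) ?index_mem ?mem_enum// nth_index ?mem_enum// => i iltn.
  by rewrite /= ffunE inordK.
- move=> C [->|[m [b [nm ->]]]]; first by rewrite !measure0.
  have [b0|nb0] := boolP (b 0%N); last first.
    rewrite (_ : record_cylinder m b = set0) ?measure0//.
    apply/seteqP; split => // w /(_ 0%N (ltn0Sn _)) /= wb.
    by move/negP: nb0; apply; rewrite -wb; exact: is_lower_record0.
  rewrite [LHS](cylinder_conditional_law b0 nm) /= /density_measure.
  rewrite (eq_integral (cst (finite_law (uniform_pmf R (perms_with_spacings n.+1 b)) A))).
    by rewrite integral_cst//; exact: measurable_record_cylinder.
  move=> w; rewrite inE => wb; rewrite /kernel /cst.
  congr (finite_law (uniform_pmf R _) A).
  apply: eq_perms_with_spacings => i iltn; apply: (wb i).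
  exact: leq_trans iltn (nm : (n.+1 <= m.+1)%N).
- move=> k; apply: (@le_lt_trans _ _ (1%E)); last exact: ltry.
  apply: probability_le1; apply: measurableI => //.
  by have [->//|[m [b [_ ->]]]] := fcyl k; exact: measurable_record_cylinder.
Qed.

Lemma uniform_conditional_law n :
  is_cond_distribution (sigma_of [set: nat] (fun i => B i : T -> bool)) (Pi n.+1)
    (fun w => finite_law (uniform_pmf R (perms_with_spacings n.+1 (fun i => B i w)))).
Proof.
move=> A _; split; first exact: measurable_kernel.
by move=> E; exact: records_conditional_law.
Qed.

(** The kernel depends on the first [n.+1] indicators only, so the identity on the
    larger sigma-algebra of all the indicators restricts to theirs. *)
Lemma feller_conditional_law n :
  is_cond_distribution (sigma_of `I_n.+1 (fun i => B i : T -> bool)) (Pi n.+1)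
    (fun w => finite_law (feller_pmf R (fun i => B i w))).
Proof.
move=> A _; have -> : (fun w => finite_law (feller_pmf R (fun i => B i w)) A) = kernel A.
  apply/funext => w; congr EFin; apply: eq_bigr => s _; apply: feller_pmf_uniform.
  exact: is_lower_record0.
split; first exact: measurable_kernel.
move=> E sE; apply: records_conditional_law; move: sE.
apply: smallest_sub; first exact: smallest_sigma_algebra.
move=> F sF; apply: sub_sigma_algebra; move: F sF; apply: smallest_sub.
  exact: smallest_sigma_algebra.
move=> _ [i _ [C mC <-]]; rewrite setTI.
exact: sigma_of_preimage.
Qed.

End conditional_laws.

Unset Implicit Arguments.
Theorem corollary1p4 (R : realType) (d : measure_display)
    (T : measurableType d) (P : probability T R) (theta : R)
    (theta_gt0 : 0 < theta) (U : nat -> {RV P >-> R})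
    (lawU : has_law_Ptheta theta U) :
  let B : nat -> {RV P >-> bool} := fun i => record_indicator U i in
  [/\ mutually_independent B /\
      (forall i : nat,
        distribution P (B i) =1 bernoulli_prob (theta / (i%:R + theta))),
      (forall n : nat, (0 < n)%N ->
        is_cond_distribution (sigma_of [set: nat] (fun i => B i : T -> bool))
          (perm_pi_rv U n : {RV P >-> {perm 'I_n}})
          (fun w => finite_law (uniform_pmf R
            (perms_with_spacings n (fun i => B i w))))),
      (forall n : nat, (0 < n)%N ->
        is_cond_distribution (sigma_of `I_n (fun i => B i : T -> bool))
          (perm_pi_rv U n : {RV P >-> {perm 'I_n}})
          (fun w => finite_law (feller_pmf R (fun i => B i w))))
    & (forall n : nat, (0 < n)%N ->
        distribution P (perm_pi_rv U n : {RV P >-> {perm 'I_n}}) =1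
          finite_law (ewens_pmf theta (n := n)))].
Proof.
move=> B; split; first split.
- exact: records_independent theta_gt0 lawU.
- exact: record_bernoulli theta_gt0 lawU.
- by case=> // n _; exact: uniform_conditional_law theta_gt0 lawU _.
- by case=> // n _; exact: feller_conditional_law theta_gt0 lawU _.
- by case=> // n _; exact: ewens_law theta_gt0 lawU _.
Qed.
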